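(* Let $\Delta$ be a shellable simplicial complex on the vertex set $[n]=\{1,\dots,n\}$ with $\dim\Delta\le n-3$. Then the intersection lattice $L_\Delta$ of the diagonal arrangement $\mathcal{A}_\Delta$ is homotopy equivalent to a wedge of spheres (i.e. the order complex of $L_\Delta-\{\hat 0,\hat 1\}$ has the homotopy type of a wedge of spheres, not necessarily all of the same dimension).
   Context: For $S\subseteq[n]$, $U_S\subseteq\mathbb{R}^n$ denotes the diagonal subspace $\{u: u_i=u_j \text{ for all } i,j\in S\}$. For a simplicial complex $\Delta$ on $[n]$ with $\dim\Delta\le n-3$, $\mathcal{A}_\Delta=\{U_{[n]-F}: F \text{ a facet of }\Delta\}$. The intersection lattice $L_\Delta$ is the set of all intersections of subspaces of $\mathcal{A}_\Delta$ (including the empty intersection $\mathbb{R}^n$, the bottom element $\hat 0$), ordered by reverse inclusion; its top element $\hat 1$ is the intersection of all subspaces. Topological statements about a lattice refer to the order complex (simplicial complex of chains) of its proper part $L-\{\hat0,\hat1\}$. A simplicial complex is shellable if its facets can be ordered $F_1,\dots,F_q$ so that for each $k\ge2$, $(\bigcup_{i<k}2^{F_i})\cap 2^{F_k}$ is pure of dimension $\dim F_k-1$ (facets may have different dimensions). *)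

(* Defs.v *)
From HB Require Import structures.
From mathcomp Require Import all_boot all_order all_algebra.
From mathcomp Require Import all_classical all_reals all_analysis.
Import Order.TTheory GRing.Theory Num.Theory.
Import numFieldNormedType.Exports.


Local Open Scope classical_set_scope.
Local Open Scope ring_scope.

Definition unit_interval (R : realType) : set R := `[0, 1].

Definition homotopic (R : realType) (X Y : topologicalType) (f g : X -> Y) : Prop :=
  exists H : (set_type (unit_interval R) * X)%type -> Y,
    continuous H /\
    (forall t x, val t = 0 -> H (t, x) = f x) /\
    (forall t x, val t = 1 -> H (t, x) = g x).

Definition homotopy_equivalent (R : realType) (X Y : topologicalType) : Prop :=
  exists (f : X -> Y) (g : Y -> X),
    continuous f /\ continuous g /\
    homotopic R X X (g \o f) id /\ homotopic R Y Y (f \o g) id.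

Definition RV (R : realType) (V : Type) :=
  prod_topology (fun _ : V => (R : topologicalType)).

Definition supp {R : realType} {V : Type} (x : V -> R) : set V :=
  [set v | x v != 0].

Definition realization (R : realType) {V : choiceType} (K : set (set V))
  : set (RV R V) :=
  [set x : RV R V | (forall v, 0 <= x v) /\ finite_set (supp x) /\
                    K (supp x) /\ \sum_(v \in supp x) x v = 1].

(** Vertex set of the wedge of spheres of dimensions ds: a common base point
    [None] and, for the i-th sphere (dimension d_i), d_i + 1 further vertices. *)
Definition wedge_vertex (ds : seq nat) : finType :=
  option {i : 'I_(size ds) & 'I_(nth 0%N ds i).+1}.

(** Faces: subsets of the vertex set {base} ∪ (vertices of sphere i) of the
    (d_i+1)-simplex other than the full simplex, i.e. the boundary of the
    (d_i+1)-simplex, all glued at the base point. For ds = [::] this is a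
    point (empty wedge). *)
Definition wedge_faces (ds : seq nat) : set (set (wedge_vertex ds)) :=
  [set S | S `<=` [set None] \/
     exists i : 'I_(size ds),
       (forall v, S v -> v = None \/ exists j, v = Some (existT _ i j)) /\
       ~ (S None /\ forall j, S (Some (existT _ i j)))].

(** X has the homotopy type of a wedge of spheres (possibly of different
    dimensions); the empty space counts as the (-1)-sphere. *)
Definition homotopy_wedge_of_spheres (R : realType) (X : topologicalType) : Prop :=
  (X -> False) \/
  exists ds : seq nat,
    homotopy_equivalent R X (set_type (realization R (wedge_faces ds))).

Definition is_simplicial_complex {n : nat} (D : {set {set 'I_n}}) : Prop :=
  finset.set0 \in D /\ (forall F G : {set 'I_n}, F \in D -> G \subset F -> G \in D).

Definition is_facet {n : nat} (D : {set {set 'I_n}}) (F : {set 'I_n}) : Prop :=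
  F \in D /\ (forall G : {set 'I_n}, G \in D -> F \subset G -> G = F).

Definition dim_le {n : nat} (D : {set {set 'I_n}}) (d : int) : Prop :=
  forall F : {set 'I_n}, F \in D -> (#|F|%:Z - 1 <= d)%R.

Definition pure_of_dim {n : nat} (C : {set {set 'I_n}}) (d : int) : Prop :=
  C != finset.set0 /\
  forall G : {set 'I_n}, G \in C -> (forall H : {set 'I_n}, H \in C -> G \subset H -> H = G) ->
    (#|G|%:Z - 1 = d)%R.

Definition shell_part {n : nat} (s : seq {set 'I_n}) (k : nat) : {set {set 'I_n}} :=
  finset (fun G : {set 'I_n} => (G \subset nth finset.set0 s k) &&
           [exists i : 'I_k, G \subset nth finset.set0 s i]).

Definition shellable {n : nat} (D : {set {set 'I_n}}) : Prop :=
  exists s : seq {set 'I_n},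
    uniq s /\ (forall F : {set 'I_n}, F \in s <-> is_facet D F) /\
    forall k, (0 < k < size s)%N ->
      pure_of_dim (shell_part s k) (#|nth finset.set0 s k|%:Z - 2)%R.

Definition Udiag (R : realType) {n : nat} (S : {set 'I_n}) : set ('I_n -> R) :=
  [set u | forall i j, i \in S -> j \in S -> u i = u j].

Definition inter_sub (R : realType) {n : nat} (G : {set {set 'I_n}}) : set ('I_n -> R) :=
  [set u | forall F : {set 'I_n}, F \in G -> Udiag R (~: F) u].

Definition int_lattice (R : realType) {n : nat} (D : {set {set 'I_n}})
  : set (set ('I_n -> R)) :=
  [set X | exists G : {set {set 'I_n}},
     (forall F : {set 'I_n}, F \in G -> is_facet D F) /\ X = inter_sub R G].

Definition lat_bot (R : realType) (n : nat) : set ('I_n -> R) := setT.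
Definition lat_top (R : realType) {n : nat} (D : {set {set 'I_n}}) : set ('I_n -> R) :=
  [set u | forall F : {set 'I_n}, is_facet D F -> Udiag R (~: F) u].

Definition proper_part (R : realType) {n : nat} (D : {set {set 'I_n}})
  : set (set ('I_n -> R)) :=
  [set X | int_lattice R D X /\ X <> lat_bot R n /\ X <> lat_top R D].

(** Order complex of the proper part: finite chains (w.r.t. the order of
    L_D, reverse inclusion; chains are the same for inclusion). *)
Definition order_complex_proper (R : realType) {n : nat} (D : {set {set 'I_n}})
  : set (set (set ('I_n -> R))) :=
  [set C | finite_set C /\ C `<=` proper_part R D /\
           (forall X Y, C X -> C Y -> X `<=` Y \/ Y `<=` X)].

(* Main.v *)
(* Let E_i be the complement of the i-th facet of the shelling. The lattice is
   the set of equivalence relations generated by squares E_i x E_i, ordered by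
   inclusion, and the shelling says that for i < k there are j < k and v in
   E_i \ E_k with E_j u E_k = E_k u {v}. By induction on the number of atoms,
   every open interval (0, y) has a set of maximal chains whose removal makes its
   order complex collapsible. The last atom E_k is a cone point over the interval
   above it; a chain of that interval splits at its greatest element w having E_k
   as a block. Below w one finds an interval of the lattice of the earlier atoms;
   above w, the elements in which E_k has grown retract either to a cone or, by
   merging E_k with the blocks of w one at a time, to the proper part of a Boolean
   lattice, a sphere. Finally, a complex from which removing some facets leaves a
   collapsible complex is a wedge of spheres: a larger complex collapses both to
   it and to a bouquet of boundaries of simplices. *)

Require Import Defs.
From HB Require Import structures.
From mathcomp Require Import all_boot.
Set Implicit Arguments.
Unset Strict Implicit.
Unset Printing Implicit Defensive.

(** * Collapsible families of simplices *)

(** Homotopy types are not tracked through the induction. What is tracked is a set [M] of critical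
    simplices, all maximal, whose removal leaves a collapsible family; this passes through joins,
    retractions and the addition of a vertex by finite bookkeeping, with spheres of several
    dimensions on the same footing. The empty simplex is matched like any other, so the empty
    complex has the empty simplex as its critical one, and the (-1)-sphere needs no separate
    treatment in joins. The obstacle is the interval above the last atom, since the induction
    hypothesis speaks only of intervals starting at the identity relation. As long as [E k] remains
    a block, dissolving it into singletons restores that form. Once the block grows, the shelling
    supplies single points by which it can grow; the ways of growing are then independent of one
    another, whence a Boolean lattice. At the end, attaching cells to a contractible complex would
    call for homotopy extension. The larger complex, with a private copy of each removed facet and
    one base point, replaces this by two collapses. *)

Section Collapse.
Variable V : finType.
Implicit Types (S : {set {set V}}) (s t : {set V}).

(* The family need not be a complex: for complexes [K' \subset K], the complex
   [K] collapses to [K'] iff [K :\: K'] is collapsible. The empty simplex takes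
   part in the pairing, so a collapsible complex is void or contractible. *)
Inductive collapsible : {set {set V}} -> Prop :=
| collapsible0 : collapsible set0
| collapsible_step S s v of v \notin s & s \in S & v |: s \in S &
    (forall t, t \in S -> s \subset t -> t = s \/ t = v |: s) &
    collapsible (S :\: [set s; v |: s]) : collapsible S.

(** [S1] goes first: since none of its simplices lies in one of [S2], a free pair of [S1] stays free
    in the union. *)
Lemma collapsibleU S1 S2 :
  collapsible S1 -> collapsible S2 ->
  (forall s t, s \in S1 -> t \in S2 -> ~~ (s \subset t)) ->
  collapsible (S1 :|: S2).
Proof.
move=> c1 c2; elim: c1 => [_|{}S1 s v vs sS vsS up c1 IH sep]; first by rewrite set0U.
apply: (@collapsible_step _ s v) => //; rewrite ?inE ?sS ?vsS //.
  move=> t; rewrite inE => /orP[|tS2 st]; first exact: up.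
  by have := sep _ _ sS tS2; rewrite st.
have -> : (S1 :|: S2) :\: [set s; v |: s] = (S1 :\: [set s; v |: s]) :|: S2.
  apply/setP => t; rewrite !inE; case: eqP => [->|_]; case: eqP => [e|_] //=;
    rewrite ?orbF; symmetry.
  - by apply/negbTE/negP => /(sep _ _ sS); rewrite subxx.
  - by apply/negbTE/negP => /(sep _ _ sS); rewrite subxx.
  - by apply/negbTE/negP => tS; have := sep _ _ vsS tS; rewrite e subxx.
by apply: IH => a b; rewrite inE => /andP[_]; exact: sep.
Qed.

(** Toggling [v] matches [S] perfectly. The pair removed starts at a largest [v]-free simplex:
    whatever contains it becomes, on losing [v], a [v]-free simplex that is no larger, hence that
    very simplex. *)
Lemma collapsible_cone S v :
  (forall s, s \in S -> v |: s \in S) -> (forall s, s \in S -> s :\ v \in S) ->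
  collapsible S.
Proof.
have [m] := ubnP #|S|; elim: m S => // m IH S Sm coneU coneD.
have [->|[s0 s0S]] := set_0Vmem S; first exact: collapsible0.
pose P s := (s \in S) && (v \notin s).
have P0 : P (s0 :\ v) by rewrite /P coneD // !inE eqxx.
case: (arg_maxnP (fun s => #|s|) P0) => s /andP[sS vs] smax.
have mem t : t \in S -> s \subset t -> t = s \/ t = v |: s.
  move=> tS st; have: P (t :\ v) by rewrite /P coneD // !inE eqxx.
  move/smax => /= le; have sub : s \subset t :\ v.
    by apply/subsetP => x xs; rewrite !inE (subsetP st) // andbT; apply: contraNneq vs => <-.
  have e : s = t :\ v by apply/eqP; rewrite eqEcard sub.
  have [vt|vt] := boolP (v \in t); first by right; rewrite e setD1K.
  by left; rewrite e; apply/setP => x; rewrite !inE; case: eqP => // ->; rewrite (negbTE vt).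
apply: (@collapsible_step _ s v) => //; first exact: coneU.
apply: IH.
- apply: leq_trans (_ : #|S| <= m) => //; apply: proper_card; apply/properP; split; first exact: subsetDl.
  by exists s => //; rewrite !inE eqxx.
- move=> t; rewrite !inE => /andP[/norP[ts tvs] tS]; rewrite coneU // andbT negb_or.
  apply/andP; split; apply/eqP.
    by move=> e; case/negP: vs; rewrite -e setU11.
  move=> e; have [vt|vt] := boolP (v \in t).
    by move/eqP: tvs; apply; rewrite -e; apply/setP => x; rewrite !inE; case: eqP => // ->.
  move/eqP: ts; apply; apply/setP => x; move/setP/(_ x): e; rewrite !inE.
  by case: eqP => // ->; rewrite (negbTE vt) (negbTE vs).
- move=> t; rewrite !inE => /andP[/norP[ts tvs] tS]; rewrite coneD // andbT negb_or.
  apply/andP; split; apply/eqP.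
    move=> e; have [vt|vt] := boolP (v \in t).
      by move/eqP: tvs; apply; rewrite -e setD1K.
    by move/eqP: ts; apply; rewrite -e; apply/setP => x; rewrite !inE; case: eqP => // ->; rewrite (negbTE vt).
  by move=> e; have := setU11 v s; rewrite -e !inE eqxx.
Qed.

(** The patchwork argument of discrete Morse theory. The rank drops whenever the key changes along
    an inclusion, so a fibre of least rank is closed upwards in [S] and may be collapsed before the
    others. *)
Lemma collapsible_fibres (K : eqType) (key : {set V} -> K) (rank : K -> nat) S :
  (forall s t, s \in S -> t \in S -> s \subset t ->
     key s = key t \/ (rank (key t) < rank (key s))%N) ->
  (forall k, collapsible [set s in S | key s == k]) ->
  collapsible S.
Proof.
have [m] := ubnP #|S|; elim: m S => // m IH S Sm mono fib.
have [->|[s0 s0S]] := set_0Vmem S; first exact: collapsible0.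
case: (arg_minnP (fun s => rank (key s)) s0S) => s sS smin.
have -> : S = [set t in S | key t == key s] :|: [set t in S | key t != key s].
  by apply/setP => t; rewrite !inE -andb_orr orbN andbT.
apply: collapsibleU => //.
- apply: IH.
  + apply: leq_trans (_ : #|S| <= m) => //; apply: proper_card; apply/properP; split.
      by apply/subsetP => t; rewrite inE => /andP[].
    by exists s => //; rewrite !inE eqxx andbF.
  + by move=> a b; rewrite !inE => /andP[aS _] /andP[bS _]; exact: mono.
  + move=> k; have [->|ks] := eqVneq k (key s).
      have -> : [set t in [set t in S | key t != key s] | key t == key s] = set0.
        by apply/setP => t; rewrite !inE -andbA andNb andbF.
      exact: collapsible0.
    have -> : [set t in [set t in S | key t != key s] | key t == k] = [set t in S | key t == k].
      apply/setP => t; rewrite !inE -andbA; congr (_ && _).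
      by case: (key t =P k) => [->|]; rewrite ?ks ?andbF.
    exact: fib.
- move=> a b; rewrite !inE => /andP[aS /eqP ka] /andP[bS /eqP kb]; apply/negP => ab.
  case: (mono _ _ aS bS ab) => [e|]; first by apply: kb; rewrite -e.
  by rewrite ka ltnNge => /negP; apply; exact: smin.
Qed.

End Collapse.

(** Reflecting inclusion keeps a pair free in the image; inclusions have to be preserved only for
    the addition of one vertex, where [g] names the vertex that [h] adds. The map [h] need not come
    from a map of vertices: it may also add a fixed simplex. *)
Lemma collapsible_map (V W : finType) (h : {set V} -> {set W}) (g : V -> W)
    (S : {set {set V}}) :
  (forall s t, s \in S -> t \in S -> h s \subset h t -> s \subset t) ->
  (forall s v, s \in S -> v |: s \in S -> v \notin s ->
     h (v |: s) = g v |: h s /\ g v \notin h s) ->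
  collapsible S -> collapsible [set h s | s in S].
Proof.
move=> hle hstep c; elim: c hle hstep => [|{}S s v vs sS vsS up c IH] hle hstep.
  by rewrite imset0; exact: collapsible0.
have inj a b : a \in S -> b \in S -> h a = h b -> a = b.
  by move=> aS bS e; apply/eqP; rewrite eqEsubset !hle // e.
have [hv gv] := hstep _ _ sS vsS vs.
apply: (@collapsible_step _ _ (h s) (g v)) => //; first exact: imset_f.
- by rewrite -hv; exact: imset_f.
- move=> _ /imsetP[t tS ->] /(hle _ _ sS tS) /(up _ tS) [->|->]; first by left.
  by right.
have -> : [set h t | t in S] :\: [set h s; g v |: h s]
        = [set h t | t in S :\: [set s; v |: s]].
  apply/setP => x; rewrite !inE; apply/andP/imsetP.
    move=> [/norP[xs xvs] /imsetP[t tS xt]]; exists t => //.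
    rewrite !inE tS andbT; apply/norP; split.
      by apply: contraNneq xs => <-; rewrite xt.
    by apply: contraNneq xvs => e; rewrite xt e hv.
  move=> [t]; rewrite !inE => /andP[/norP[ts tvs] tS] ->; split; last exact: imset_f.
  apply/norP; split; first by apply: contraNneq ts => /(inj _ _ tS sS) ->.
  by rewrite -hv; apply: contraNneq tvs => /(inj _ _ tS vsS) ->.
apply: IH => [a b|a w]; first by rewrite !inE => /andP[_ aS] /andP[_ bS]; exact: hle.
by rewrite !inE => /andP[_ aS] /andP[_ bS]; exact: hstep.
Qed.

(** * Joins of families of simplices *)

Section Join.
Variable V : finType.
Implicit Types (A B : {set V}) (K M : {set {set V}}).

(** The simplices with a fixed trace [k] on [B] form a copy of [K1], whatever [K2] is. Larger traces
    are cleared first. *)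
Lemma collapsible_join1 A B K1 K2 :
  [disjoint A & B] -> collapsible K1 -> K1 \subset powerset A ->
  collapsible [set s : {set V} | [&& s \subset A :|: B, s :&: A \in K1 & s :&: B \in K2]].
Proof.
move=> dAB c1 K1A; set S := [set s | _].
have AB0 : A :&: B = set0 by apply/eqP; rewrite setI_eq0.
apply: (@collapsible_fibres _ _ (fun s => s :&: B) (fun t => #|V| - #|t|)).
  move=> s t _ _ st; have [|neq] := eqVneq (s :&: B) (t :&: B); first by left.
  right; apply: ltn_sub2l.
    apply: leq_trans (max_card (mem (t :&: B))).
    by apply: proper_card; rewrite properEneq neq setSI.
  by apply: proper_card; rewrite properEneq neq setSI.
move=> k; have [/andP[kB kK2]|nk] := boolP ((k \subset B) && (k \in K2)); last first.
  have -> : [set s : {set V} in S | s :&: B == k] = set0.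
    apply/setP => s; rewrite !inE; apply/negbTE; apply: contra nk.
    by move=> /andP[/and3P[_ _ h] /eqP <-]; rewrite subsetIr.
  exact: collapsible0.
have dk (s : {set V}) : s \subset A -> (s :|: k) :&: A = s /\ (s :|: k) :&: B = k.
  move=> sA; rewrite !setIUl; have -> : k :&: A = set0.
    by apply/eqP; rewrite -subset0 -AB0 setIC; apply: setIS.
  have -> : s :&: B = set0 by apply/eqP; rewrite -subset0 -AB0; apply: setSI.
  by rewrite setU0 set0U; split; apply/setIidPl.
have -> : [set s : {set V} in S | s :&: B == k] = (fun s : {set V} => s :|: k) @: K1.
  apply/setP => s; rewrite !inE; apply/andP/imsetP.
    move=> [/and3P[sAB sK1 _] /eqP <-]; exists (s :&: A) => //.
    by rewrite -setIUr; apply/esym/setIidPl.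
  move=> [t tK1 ->]; have tA : t \subset A by have := subsetP K1A _ tK1; rewrite inE.
  have [-> ->] := dk _ tA; rewrite tK1 kK2 eqxx; split => //.
  by rewrite andbT subUset (subset_trans tA (subsetUl _ _)) (subset_trans kB (subsetUr _ _)).
apply: (@collapsible_map _ _ (fun s => s :|: k) id) => //.
- move=> s t /(subsetP K1A); rewrite inE => sA /(subsetP K1A); rewrite inE => tA st.
  by have [<- _] := dk _ sA; have [<- _] := dk _ tA; rewrite setSI.
- move=> s v _ /(subsetP K1A); rewrite inE => vsA vs; split; first by rewrite setUA.
  rewrite inE (negbTE vs) /=; apply/negP => vk.
  have: v \in A :&: B by rewrite inE (subsetP vsA) ?setU11 // (subsetP kB).
  by rewrite AB0 inE.
Qed.

(** The critical simplices of a join are the joins of critical ones. The rest has two layers: trace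
    in [M1] on [A] but outside [M2] on [B], and trace outside [M1] on [A]. Maximality of [M1] in
    [K1] puts the first layer on top. *)
Lemma collapsible_join A B K1 K2 M1 M2 :
  [disjoint A & B] -> K1 \subset powerset A -> K2 \subset powerset B ->
  (forall s t, s \in M1 -> t \in K1 -> s \subset t -> t = s) ->
  collapsible (K1 :\: M1) -> collapsible (K2 :\: M2) ->
  collapsible [set s : {set V} | [&& s \subset A :|: B, s :&: A \in K1, s :&: B \in K2 &
                            ~~ ((s :&: A \in M1) && (s :&: B \in M2))]].
Proof.
move=> dAB K1A K2B facet c1 c2.
have -> : [set s : {set V} | [&& s \subset A :|: B, s :&: A \in K1, s :&: B \in K2 &
                            ~~ ((s :&: A \in M1) && (s :&: B \in M2))]]
  = [set s : {set V} | [&& s \subset B :|: A, s :&: B \in K2 :\: M2 & s :&: A \in K1 :&: M1]]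
    :|: [set s : {set V} | [&& s \subset A :|: B, s :&: A \in K1 :\: M1 & s :&: B \in K2]].
  apply/setP => s; rewrite !inE (setUC B A); case: (s \subset _) => //=.
  by case: (s :&: A \in K1); case: (s :&: A \in M1);
     case: (s :&: B \in K2); case: (s :&: B \in M2).
apply: collapsibleU.
- apply: collapsible_join1 => //; first by rewrite disjoint_sym.
  by apply: subset_trans K2B; exact: subsetDl.
- apply: collapsible_join1 => //.
  by apply: subset_trans K1A; exact: subsetDl.
- move=> s t; rewrite !inE => /and3P[_ _ /andP[sK sM]] /and3P[_ /andP[tM tK] _].
  apply/negP => st; move/negP: tM; apply.
  by rewrite (facet _ _ sM tK) // setSI.
Qed.

End Join.

(** * Order complexes: cones, added points, retractions and splittings *)

Section OrderComplex.
Variables (V : finType) (le : rel V).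
Hypotheses (lexx : reflexive le) (le_trans : transitive le) (le_anti : antisymmetric le).
Implicit Types (P C D : {set V}) (F N : {set {set V}}).

Definition chains P : {set {set V}} :=
  [set C : {set V} | (C \subset P) &&
     [forall x in C, forall y in C, le x y || le y x]].

Lemma chainsP P C :
  reflect (C \subset P /\ {in C &, forall x y, le x y || le y x}) (C \in chains P).
Proof.
rewrite inE; apply: (iffP andP) => -[CP h]; split=> //.
  by move=> x y xC yC; move/forall_inP/(_ x xC)/forall_inP/(_ y yC): h.
by apply/forall_inP => x xC; apply/forall_inP => y yC; exact: h.
Qed.

Lemma chains_sub P C C' : C' \subset C -> C \in chains P -> C' \in chains P.
Proof.
move=> s /chainsP[CP h]; apply/chainsP; split; first exact: subset_trans CP.
by move=> x y /(subsetP s) xC /(subsetP s); exact: h.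
Qed.

Lemma chainsU1 P C a : a \in P -> C \in chains P ->
  {in C, forall x, le x a || le a x} -> a |: C \in chains P.
Proof.
move=> aP /chainsP[CP h] ha; apply/chainsP; split.
  by rewrite subUset sub1set aP.
move=> x y /setU1P[->|xC] /setU1P[->|yC]; rewrite ?lexx ?ha //.
  by rewrite orbC ha.
exact: h.
Qed.

Lemma collapsible_chains_cone P a : a \in P ->
  {in P, forall x, le x a || le a x} -> collapsible (chains P).
Proof.
move=> aP ha; apply: (@collapsible_cone _ _ a) => C CP.
  by apply: chainsU1 => // x xC; apply: ha; case/chainsP: CP => /subsetP /(_ x xC).
by apply: chains_sub CP; exact: subsetDl.
Qed.

Lemma chainsS P P' : P \subset P' -> chains P \subset chains P'.
Proof.
move=> s; apply/subsetP => C /chainsP[CP h]; apply/chainsP; split=> //.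
exact: subset_trans s.
Qed.

Lemma in_chains P C x : C \in chains P -> x \in C -> x \in P.
Proof. by case/chainsP => /subsetP h _; exact: h. Qed.

Lemma collapsible_setU1 (F : {set {set V}}) a :
  (forall C, C \in F -> a \notin C) -> collapsible F ->
  collapsible [set a |: C | C in F].
Proof.
move=> h; apply: (@collapsible_map _ _ (fun C : {set V} => a |: C) id).
  by move=> C D /h aC /h aD CD; rewrite -(setU1K aC) -(setU1K aD) setSD.
move=> C v _ /h aD vC; split; first by rewrite setUCA.
rewrite !inE negb_or vC andbT; apply: contraNneq aD => ->; exact: setU11.
Qed.

(** The chains through [a] form a copy of the chains of elements comparable with [a], and none of
    them lies in a chain avoiding [a]; so they go first, and the critical chains of the two pieces
    add up. *)
Lemma collapsible_point P a N N' :
  a \in P -> N \subset chains (P :\ a) ->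
  N' \subset chains [set z in P :\ a | le z a || le a z] ->
  collapsible (chains (P :\ a) :\: N) ->
  collapsible (chains [set z in P :\ a | le z a || le a z] :\: N') ->
  collapsible (chains P :\: (N :|: [set a |: C | C in N'])).
Proof.
move=> aP NP; set L := [set z in P :\ a | _] => N'L cN cN'.
have LP : L \subset P :\ a by apply/subsetP => z /setIdP[].
have aL C : C \in chains L -> a \notin C.
  by move=> CL; apply/negP => /(in_chains CL) /(subsetP LP); rewrite !inE eqxx.
have aD C : C \in chains (P :\ a) -> a \notin C.
  by move=> CL; apply/negP => /(in_chains CL); rewrite !inE eqxx.
have -> : chains P :\: (N :|: [set a |: C | C in N'])
  = [set a |: C | C in chains L :\: N'] :|: (chains (P :\ a) :\: N).
  apply/setP => C; rewrite in_setD in_setU negb_or in_setU in_setD.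
  have [aC|aC] := boolP (a \in C); last first.
    have -> : (C \in chains P) = (C \in chains (P :\ a)).
      by apply/chainsP/chainsP => -[CP h]; split=> //; move: CP; rewrite subsetD1 ?aC ?andbT.
    have noa F : (C \in [set a |: D | D in F]) = false.
      by apply/negbTE/imsetP => -[D _ e]; rewrite e setU11 in aC.
    by rewrite !noa andbT.
  have -> : (C \in chains (P :\ a)) = false by apply/negbTE; apply: contraL aC; exact: aD.
  have -> : (C \in N) = false by apply/negbTE; apply: contraL aC => /(subsetP NP); exact: aD.
  rewrite /= orbF; apply/andP/imsetP.
    move=> [CN CP]; exists (C :\ a); last by rewrite setD1K.
    rewrite in_setD; apply/andP; split.
      by apply: contra CN => h; apply/imsetP; exists (C :\ a) => //; rewrite setD1K.
    case/chainsP: CP => /subsetP CP Ch; apply/chainsP; split; last first.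
      by move=> x y /setD1P[_ xC] /setD1P[_ yC]; exact: Ch.
    apply/subsetP => z /setD1P[za zC]; apply/setIdP; split; last exact: Ch.
    by rewrite in_setD1 za CP.
  move=> [D /setDP[DL DN] ->]; split.
    apply: contra DN => /imsetP[D' D'N e].
    suff -> : D = D' by [].
    by rewrite -(setU1K (aL _ DL)) e setU1K //; apply: aL; exact: (subsetP N'L).
  apply: chainsU1 => //; last by move=> x /(in_chains DL) /setIdP[].
  by move: DL; apply: subsetP; apply: chainsS; apply: subset_trans LP (subD1set _ _).
apply: collapsibleU => //.
  by apply: collapsible_setU1 => // C /setDP[CL _]; exact: aL.
move=> s t /imsetP[C _ ->] /setDP[/aD at' _]; apply: contra at' => /subsetP; apply.
exact: setU11.
Qed.

(* A chain meeting [P :\: P0] is matched by toggling [f z], where [z] is its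
   least element outside [P0]; toggling does not change [z]. *)
Lemma collapsible_retract P P0 (f : V -> V) N :
  P0 \subset P -> N \subset chains P0 ->
  {in P, forall z, f z \in P0} -> {in P, forall z, le (f z) z} ->
  {in P0, forall z, f z = z} -> {in P &, forall x y, le x y -> le (f x) (f y)} ->
  collapsible (chains P0 :\: N) -> collapsible (chains P :\: N).
Proof.
move=> P0P NP0 fP0 fle ffix fmono c0.
have -> : chains P :\: N = (chains P :\: chains P0) :|: (chains P0 :\: N).
  apply/setP => C; rewrite !inE.
  have h : (C \subset P0) -> C \subset P by move=> s; exact: subset_trans P0P.
  case: (boolP (C \in N)) => [/(subsetP NP0)|]; first by rewrite inE => ->.
  move=> _ /=; case: (boolP (C \subset P0)) => [/h ->|_] /=; last by rewrite orbF.
  by case: [forall _ in _, _].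
apply: collapsibleU => //; last first.
  move=> s t; rewrite !in_setD => /andP[sN _] /andP[_ tP0]; apply/negP => st.
  by case/negP: sN; exact: chains_sub tP0.
pose key (C : {set V}) := [pick z in C | (z \notin P0) && [forall y in C, (y \notin P0) ==> le z y]].
(* The least element outside [P0] can only go down when the chain grows, so its height, measured by
   [down], can serve as the rank. *)
pose down (z : V) := #|[set y | le y z]|.
have down_lt x y : le x y -> x != y -> (down x < down y)%N.
  move=> xy nxy; apply: proper_card; apply/properP; split.
    by apply/subsetP => z; rewrite !inE => /le_trans; apply.
  exists y; rewrite !inE ?lexx //; apply: contra nxy => yx.
  by apply/eqP/le_anti; rewrite xy.
pose isk (C : {set V}) z := [/\ z \in C, z \notin P0 & {in C, forall y, y \notin P0 -> le z y}].
have key_uniq C z : isk C z -> key C = Some z.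
  move=> [zC zP zmin]; rewrite /key; case: pickP => [z' |/(_ z)].
    move=> /and3P[z'C z'P /forall_inP h]; congr Some; apply: le_anti.
    by rewrite zmin // andbT; apply: (implyP (h _ zC)).
  by rewrite /= zC zP /= => /negP[]; apply/forall_inP => y yC; apply/implyP; exact: zmin.
have keyP C : C \in chains P :\: chains P0 -> exists z, isk C z.
  rewrite in_setD => /andP[nC /chainsP[CP Ch]].
  have [x xC xP0] : exists2 x, x \in C & x \notin P0.
    apply/subsetPn; apply: contra nC => s; apply/chainsP; split => //.
  have xx : [pred w | (w \in C) && (w \notin P0)] x by rewrite /= xC.
  case: (arg_minnP down xx) => z /= /andP[zC zP] zmin; exists z; split => // y yC yP.
  case/orP: (Ch _ _ zC yC) => // yz; have [->|nzy] := eqVneq z y; first exact: lexx.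
  have := zmin y; rewrite yC yP => /(_ isT); rewrite leqNgt down_lt //.
  by rewrite eq_sym.
apply: (@collapsible_fibres _ _ key (fun o => if o is Some z then down z else 0)).
  move=> s t sS tS st; have [z zk] := keyP _ sS; have [z' zk'] := keyP _ tS.
  rewrite (key_uniq _ _ zk) (key_uniq _ _ zk').
  have [->|nz] := eqVneq z z'; [by left|right; apply: down_lt; last by rewrite eq_sym].
  by case: zk zk' => zs zP _ [_ _]; apply => //; exact: (subsetP st).
case=> [z|]; last first.
  have -> : [set s in chains P :\: chains P0 | key s == None] = set0.
    apply/setP => s; rewrite inE in_set0; apply/negbTE/negP => /andP[sS].
    by have [z /key_uniq ->] := keyP _ sS.
  exact: collapsible0.
apply: (@collapsible_cone _ _ (f z)) => C;
  move=> /setIdP[CS /eqP kC];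
  have [z' zk] := keyP _ CS; move: (zk) kC => /key_uniq -> [e]; subst z';
  move: CS; rewrite in_setD => /andP[CP0 CP]; case: (zk) => zC zP0 zmin;
  have /chainsP[/subsetP sCP Cch] := CP;
  have zP := sCP _ zC;
  have fzP0 := fP0 _ zP.
- have fzP : f z \in P by exact: (subsetP P0P).
  have ch : f z |: C \in chains P.
    (* [f z] is comparable with the whole chain. Elements above [z] are above [f z]; an element of
       [P0] below [z] is fixed by [f], hence below [f z]; and minimality of [z] leaves nothing else
       below [z] except [z] itself. *)
    apply: chainsU1 => // x xC; case/orP: (Cch _ _ xC zC) => [xz|zx]; last first.
      by rewrite orbC (le_trans (fle _ zP) zx).
    have [xP0|xP0] := boolP (x \in P0).
      by rewrite -{1}(ffix _ xP0) (fmono _ _ (sCP _ xC) zP xz).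
    have -> : x = z by apply: le_anti; rewrite xz zmin.
    by rewrite fle // orbT.
  have kk : isk (f z |: C) z.
    split=> //; first by rewrite setU1r.
    by move=> y /setU1P[->|]; rewrite ?fzP0 //; exact: zmin.
  have nP0 : f z |: C \notin chains P0.
    apply/negP => /chainsP[/subsetP/(_ z)]; rewrite setU1r // => /(_ isT).
    by rewrite (negbTE zP0).
  by apply/setIdP; rewrite in_setD nP0 ch (key_uniq _ _ kk).
- have ch : C :\ f z \in chains P by apply: chains_sub CP; exact: subsetDl.
  have znf : z != f z by apply: contraNneq zP0 => ->.
  have kk : isk (C :\ f z) z.
    split=> //; first by rewrite !inE znf.
    by move=> y; rewrite in_setD1 => /andP[_]; exact: zmin.
  have nP0 : C :\ f z \notin chains P0.
    apply/negP => /chainsP[/subsetP/(_ z)]; rewrite !inE znf zC => /(_ isT).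
    by rewrite (negbTE zP0).
  by apply/setIdP; rewrite in_setD nP0 ch (key_uniq _ _ kk).
Qed.

(* A chain of [R] meeting the down-set [W] splits at the greatest element [w] of
   [W] it contains into a chain below [w] and a chain of [R :\: W] above [w]. *)
Lemma collapsible_split (R W : {set V}) N0 (NL NU : V -> {set {set V}})
    (below := fun w => [set z in W | le z w & z != w])
    (above := fun w => [set z in R :\: W | le w z]) :
  W \subset R -> (forall z w, z \in R -> w \in W -> le z w -> z \in W) ->
  N0 \subset chains (R :\: W) -> collapsible (chains (R :\: W) :\: N0) ->
  (forall w, w \in W -> forall C D, C \in NL w -> D \in chains (below w) ->
     C \subset D -> D = C) ->
  (forall w, w \in W -> collapsible (chains (below w) :\: NL w)) ->
  (forall w, w \in W -> collapsible (chains (above w) :\: NU w)) ->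
  collapsible (chains R :\: (N0 :|: [set C in chains R | [exists w in W,
    [&& w \in C, C \subset w |: (below w :|: above w),
        C :&: below w \in NL w & C :&: above w \in NU w]]])).
Proof.
move=> WR Wdown N0R c0 facet cL cU; set N1 := [set C in chains R | _].
pose top (C : {set V}) w := [/\ w \in W, w \in C & C \subset w |: (below w :|: above w)].
have topP C w : C \in chains R ->
    top C w <-> [/\ w \in W, w \in C & forall z, z \in C -> z \in W -> le z w].
  move=> CR; split=> -[wW wC h]; split=> //.
    move=> z zC zW; have := subsetP h _ zC; rewrite in_setU1 in_setU => /orP[/eqP ->//|].
    by case/orP=> /setIdP[]; [move=> _ /andP[]|rewrite in_setD zW].
  apply/subsetP => z zC; rewrite in_setU1; case: eqP => //= /eqP zw.
  rewrite in_setU; have [zW|zW] := boolP (z \in W).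
    by apply/orP; left; apply/setIdP; rewrite zW h.
  apply/orP; right; apply/setIdP; rewrite in_setD zW (in_chains CR) //; split=> //.
  have /chainsP[_ /(_ _ _ zC wC)/orP[zw'|//]] := CR.
  by rewrite (Wdown _ _ _ wW zw') ?(in_chains CR) // in zW.
pose key (C : {set V}) := [pick w in W | (w \in C) && (C \subset w |: (below w :|: above w))].
have key_uniq C w : C \in chains R -> top C w -> key C = Some w.
  move=> CR tw; rewrite /key; case: pickP => [w' /and3P[w'W w'C h]|/(_ w)]; last first.
    by case: tw => wW wC h; rewrite /= wW wC h.
  have /(topP _ _ CR)[_ _ h'] : top C w' by [].
  case/(topP _ _ CR): tw => wW wC h''; congr Some; apply: le_anti.
  by rewrite h'' //= h'.
pose down w := #|[set z | le z w]|.
have down_lt x y : le x y -> x != y -> (down x < down y)%N.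
  move=> xy nxy; apply: proper_card; apply/properP; split.
    by apply/subsetP => z; rewrite !inE => /le_trans; apply.
  exists y; rewrite !inE ?lexx //; apply: contra nxy => yx.
  by apply/eqP/le_anti; rewrite xy.
have keyN C : C \in chains R -> key C = None -> C \in chains (R :\: W).
  move=> CR kC; case/chainsP: (CR) => /subsetP CsR Ch; apply/chainsP; split=> //.
  apply/subsetP => z zC; rewrite in_setD CsR // andbT; apply/negP => zW.
  have zz : [pred w | (w \in W) && (w \in C)] z by rewrite /= zW.
  case: (arg_maxnP down zz) => w /= /andP[wW wC] wmax.
  have tw : top C w.
    apply/(topP _ _ CR); split=> // x xC xW; case/orP: (Ch _ _ xC wC) => // wx.
    have [->|nwx] := eqVneq w x; first exact: lexx.
    by have := wmax x; rewrite /= xW xC => /(_ isT); rewrite leqNgt down_lt.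
  by have := key_uniq _ _ CR tw; rewrite kC.
have keyS C w : key C = Some w -> top C w.
  by rewrite /key; case: pickP => // w' /and3P[? ? ?] [<-].
(* Chains with a higher [w] are cleared earlier; those avoiding [W] get the largest rank and come
   last, where [c0] takes care of them. *)
apply: (@collapsible_fibres _ _ key (fun o => if o is Some w then #|V| - down w else #|V|.+1)).
  move=> C D /setDP[CR _] /setDP[DR _] CD.
  case kD: (key D) => [w|]; last first.
    case kC: (key C) => [w'|]; last by left.
    have [w'W w'C _] := keyS _ _ kC.
    have := in_chains (keyN _ DR kD) (subsetP CD _ w'C).
    by rewrite in_setD w'W.
  have /(topP _ _ DR)[wW wD wmax] := keyS _ _ kD.
  case kC: (key C) => [w'|]; last first.
    by right; rewrite ltnS leq_subr.
  have /(topP _ _ CR)[w'W w'C _] := keyS _ _ kC.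
  have [->|nw] := eqVneq w' w; [by left|right].
  have lt := down_lt _ _ (wmax _ (subsetP CD _ w'C) w'W) nw.
  by apply: ltn_sub2l => //; apply: leq_trans lt _; exact: max_card.
case=> [w|]; last first.
  have -> : [set C in chains R :\: (N0 :|: N1) | key C == None] = chains (R :\: W) :\: N0.
    apply/setP => C; apply/setIdP/setDP.
      move=> [/setDP[CR CN] /eqP kC]; split; first exact: keyN.
      by apply: contra CN => CN; rewrite in_setU CN.
    move=> [CRW CN]; have CR : C \in chains R.
      by apply: subsetP CRW; apply: chainsS; exact: subsetDl.
    split; last first.
      case kC : (key C) => [w|] //; have [wW wC _] := keyS _ _ kC.
      by have := in_chains CRW wC; rewrite in_setD wW.
    apply/setDP; split=> //; rewrite in_setU negb_or CN /=; apply/negP => /setIdP[_].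
    move=> /exists_inP[w wW /andP[wC _]].
    by have := in_chains CRW wC; rewrite in_setD wW.
  exact: c0.
have [wW|wW] := boolP (w \in W); last first.
  have -> : [set C in chains R :\: (N0 :|: N1) | key C == Some w] = set0.
    apply/setP => C; rewrite in_set0; apply/negbTE/negP => /setIdP[_ /eqP /keyS[]].
    by rewrite (negbTE wW).
  exact: collapsible0.
(* With [w] left out, the fibre over [w] is the join of the chains below [w] and above [w], without
   the joins of critical chains. *)
pose J := [set s : {set V} | [&& s \subset below w :|: above w,
   s :&: below w \in chains (below w), s :&: above w \in chains (above w) &
   ~~ ((s :&: below w \in NL w) && (s :&: above w \in NU w))]].
have wba : w \notin below w :|: above w.
  by rewrite in_setU !inE eqxx wW !andbF.
have wb : w \notin below w by apply: contra wba => h; rewrite in_setU h.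
have wa : w \notin above w by apply: contra wba => h; rewrite in_setU h orbT.
have Iw (P s : {set V}) : w \notin P -> (w |: s) :&: P = s :&: P.
  move=> wP; rewrite setIUl; have -> : [set w] :&: P = set0; last by rewrite set0U.
  by apply/eqP; rewrite setI_eq0 disjoints1.
have bR : below w \subset R.
  by apply: subset_trans WR; apply/subsetP => z /setIdP[].
have aR : above w \subset R.
  by apply/subsetP => z /setIdP[/setDP[]].
have -> : [set C in chains R :\: (N0 :|: N1) | key C == Some w] = [set w |: C | C in J].
  apply/setP => C; apply/setIdP/imsetP.
    move=> [/setDP[CR CN] /eqP kC]; have [_ wC Cw] := keyS _ _ kC.
    have e : C = w |: (C :\ w) by rewrite setD1K.
    exists (C :\ w) => //; rewrite inE.
    have CI (P : {set V}) : w \notin P -> (C :\ w) :&: P = C :&: P.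
      by move=> wP; rewrite {2}e Iw.
    rewrite !CI //; apply/and4P; split.
    - by apply/subsetP => z /setD1P[zw /(subsetP Cw)]; rewrite in_setU1 (negbTE zw).
    - apply/chainsP; split; first exact: subsetIr.
      by case/chainsP: CR => _ h x y /setIP[xC _] /setIP[yC _]; exact: h.
    - apply/chainsP; split; first exact: subsetIr.
      by case/chainsP: CR => _ h x y /setIP[xC _] /setIP[yC _]; exact: h.
    - apply: contra CN => /andP[h1 h2]; rewrite in_setU; apply/orP; right; apply/setIdP.
      by split=> //; apply/exists_inP; exists w => //; rewrite wC Cw h1.
  move=> [D + ->]; rewrite inE => /and4P[Dw /chainsP[_ Db] /chainsP[_ Da] DN].
  have Dcase z : z \in D -> (z \in D :&: below w) \/ (z \in D :&: above w).
    by move=> zD; have := subsetP Dw _ zD; rewrite !inE zD => /orP[]; [left|right].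
  have lb z : z \in D :&: below w -> le z w by move=> /setIP[_ /setIdP[_ /andP[]]].
  have la z : z \in D :&: above w -> le w z by move=> /setIP[_ /setIdP[]].
  have CR : w |: D \in chains R.
    apply: chainsU1; first exact: (subsetP WR).
      apply/chainsP; split.
        by apply: subset_trans Dw _; rewrite subUset bR.
      move=> x y /Dcase[xb|xa] /Dcase[yb|ya].
      - exact: Db.
      - by rewrite (le_trans (lb _ xb) (la _ ya)).
      - by rewrite orbC (le_trans (lb _ yb) (la _ xa)).
      - exact: Da.
    by move=> x /Dcase[/lb ->|/la ->]; rewrite ?orbT.
  have tw : top (w |: D) w by split=> //; [exact: setU11|exact: setUS].
  split; last by rewrite (key_uniq _ _ CR tw).
  apply/setDP; split=> //; rewrite in_setU; apply/norP; split.
    apply/negP => /(subsetP N0R)/in_chains/(_ (setU11 _ _)).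
    by rewrite in_setD wW.
  apply: contra DN => /setIdP[_ /exists_inP[w' w'W /and4P[w'D sub h1 h2]]].
  have tw' : top (w |: D) w' by [].
  have [ww] : Some w = Some w' by rewrite -(key_uniq _ _ CR tw) (key_uniq _ _ CR tw').
  by move: h1 h2; rewrite -ww !Iw // => -> ->.
apply: collapsible_setU1.
  move=> C; rewrite inE => /andP[/subsetP h _]; apply: contra wba; exact: h.
apply: collapsible_join; [| | |exact: facet|exact: cL|exact: cU].
- rewrite -setI_eq0; apply/eqP/setP => z; rewrite !inE.
  by case: (z \in W); rewrite ?andbF.
- by apply/subsetP => C /chainsP[CP _]; rewrite inE.
- by apply/subsetP => C /chainsP[CP _]; rewrite inE.
Qed.

End OrderComplex.

Lemma chains_dual (V : finType) (le : rel V) (P : {set V}) :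
  chains (fun x y => le y x) P = chains le P.
Proof.
by apply/setP => C; apply/chainsP/chainsP => -[CP h]; split=> // x y xC yC;
  rewrite orbC; exact: h.
Qed.

(** * The proper part of a Boolean lattice *)

Section Boolean.
Variables (V : finType) (le : rel V).
Hypotheses (lexx : reflexive le) (le_trans : transitive le) (le_anti : antisymmetric le).
Variables (I : finType) (phi : {set I} -> V).

Definition proper_subsets (X : {set I}) : {set V} :=
  phi @: [set S : {set I} | (S != set0) && (S \proper X)].

(* The removed chain is a flag of coatoms: drop [b], then recurse in [X :\ b].
   Without the coatom [phi (X :\ b)], adding [b] retracts the rest to a cone. *)
Lemma collapsible_boolean (X : {set I}) :
  X != set0 ->
  (forall S S' : {set I}, S \subset X -> S' \subset X -> le (phi S) (phi S') = (S \subset S')) ->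
  exists C, [/\ C \in chains le (proper_subsets X),
    collapsible (chains le (proper_subsets X) :\ C) &
    forall x, le (phi set0) x -> le x (phi X) -> {in C, forall y, le x y || le y x} ->
    exists (S : {set I}) b, [/\ S \subset X, b \in X, b \notin S, le (phi S) x /\ le x (phi (b |: S)) &
      (S = set0 \/ phi S \in C) /\ (b |: S = X \/ phi (b |: S) \in C)]].
Proof.
have [m] := ubnP #|X|; elim: m X => // m IH X Xm /set0Pn[b bX] emb.
have emb_inj (S S' : {set I}) : S \subset X -> S' \subset X -> phi S = phi S' -> S = S'.
  by move=> SX S'X e; apply/eqP; rewrite eqEsubset -[S \subset S']emb // -[S' \subset S]emb // e lexx.
pose X' := X :\ b; pose P := proper_subsets X; rewrite -/P.
have X'X : X' \subset X by exact: subsetDl.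
have X'pX : X' \proper X by exact: properD1.
have bX' : b |: X' = X by exact: setD1K.
have inP (S : {set I}) : S != set0 -> S \proper X -> phi S \in P.
  by move=> S0 SX; apply: imset_f; rewrite inE S0.
(* For a singleton [X] the proper part is empty, a (-1)-sphere, and its critical chain is the empty
   one. *)
have [X'0|X'n0] := eqVneq X' set0.
  have XE : X = [set b] by rewrite -bX' X'0 setU0.
  have P0 : P = set0.
    apply/setP => x; rewrite inE; apply/negbTE/imsetP => -[S]; rewrite inE XE.
    rewrite properE subset1 => /and3P[/negbTE S0]; rewrite S0 orbF => /eqP ->.
    by rewrite subxx.
  exists set0; split.
  - by apply/chainsP; rewrite sub0set; split=> // x; rewrite inE.
  - have -> : chains le P :\ set0 = set0.
      apply/setP => C; rewrite in_setD1 in_set0; apply/negbTE/negP.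
      by rewrite P0 => /andP[C0 /chainsP[]]; rewrite subset0 (negbTE C0).
    exact: collapsible0.
  - move=> x x0 xX _; exists set0, b; rewrite sub0set inE setU0; split=> //.
      by rewrite -XE.
    by split; left.
have {IH} [C' [C'P' c' maxC']] : _ := IH X' (leq_trans (proper_card X'pX) Xm) X'n0
  (fun (S S' : {set I}) a a' => emb S S' (subset_trans a X'X) (subset_trans a' X'X)).
pose s := phi X'.
have sP : s \in P by exact: inP.
have P'P : proper_subsets X' \subset P.
  apply/subsetP => _ /imsetP[S + ->]; rewrite inE => /andP[S0 SX'].
  by apply: inP => //; exact: proper_trans X'pX.
have P's x : x \in proper_subsets X' -> le x s && (x != s).
  move=> /imsetP[S + ->]; rewrite inE => /andP[S0 SX'].
  have SX := subset_trans (proper_sub SX') X'X.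
  rewrite emb // (proper_sub SX') /=; apply/eqP => /(emb_inj _ _ SX X'X) e.
  by rewrite e properxx in SX'.
have P's' x : x \in P -> x != s -> le x s || le s x -> x \in proper_subsets X'.
  move=> /imsetP[S + ->]; rewrite inE => /andP[S0 SX] ns.
  rewrite (emb _ _ (proper_sub SX) X'X) (emb _ _ X'X (proper_sub SX)).
  have nSX' : S != X' by apply: contraNneq ns => ->.
  case/orP => h; first by apply: imset_f; rewrite inE S0 properEneq nSX' h.
  have [bS|bS] := boolP (b \in S).
    have: X \subset S by rewrite -bX' subUset sub1set bS.
    by move=> XS; move: SX; rewrite properE XS andbF.
  case/negP: nSX'; rewrite eqEsubset h andbT; apply/subsetP => z zS.
  by rewrite !inE (subsetP (proper_sub SX)) // andbT; apply: contraNneq bS => <-.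
have C'P : C' \in chains le P.
  case/chainsP: C'P' => sC' h; apply/chainsP; split=> //; exact: subset_trans P'P.
have C'sub : {subset C' <= proper_subsets X'} by case/chainsP: C'P' => /subsetP.
have sC' : s \notin C' by apply/negP => /C'sub /P's; rewrite eqxx andbF.
exists (s |: C'); split.
- by apply: chainsU1 => // x /C'sub /P's /andP[->].
- have -> : chains le P :\ (s |: C')
            = chains le P :\: (set0 :|: [set s |: C | C in [set C']]).
    by rewrite imset_set1 set0U.
  have LE : [set z in P :\ s | le z s || le s z] = proper_subsets X'.
    apply/setP => z; apply/setIdP/idP => [[/setD1P[zs zP] h]|zX']; first exact: P's'.
    by case/andP: (P's _ zX') => zs ns; rewrite zs in_setD1 ns (subsetP P'P).
  apply: collapsible_point => //; rewrite ?LE ?sub0set ?sub1set //.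
  (* [S] is read off from [phi S] by the singletons below it, so that adding [b] becomes a map on
     [V]. *)
  pose f x := phi (b |: [set i in X | le (phi [set i]) x]).
  have fS (S : {set I}) : S \subset X -> f (phi S) = phi (b |: S).
    move=> SX; rewrite /f; congr (phi (b |: _)); apply/setP => i; rewrite inE.
    have [iX|iX] := boolP (i \in X); last by apply/esym/negbTE; apply: contra iX => /(subsetP SX).
    by rewrite emb ?sub1set.
  pose P0 := phi @: [set S : {set I} | (b \in S) && (S \proper X)].
  have Pbs x : x \in P :\ s -> exists S, [/\ x = phi S, S != set0 & (b |: S) \proper X].
    move=> /setD1P[xs /imsetP[S]]; rewrite inE => /andP[S0 SX] xE; exists S; split=> //.
    rewrite properEneq subUset sub1set bX proper_sub // !andbT.
    apply: contraNneq xs => e; rewrite xE; apply/eqP; congr phi.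
    have bS : b \notin S.
      by apply/negP => bS; move: SX; rewrite -e properE subUset sub1set bS subxx /= andbF.
    by rewrite /X' -e setU1K.
  (* Adding [b] moves elements up, whereas [collapsible_retract] moves them down; hence the reversed
     order, which has the same chains. *)
  rewrite -chains_dual; apply: (@collapsible_retract _ _ _ _ _ _ P0 f).
  - exact: lexx.
  - by move=> x y z /= h1 h2; apply: le_trans h1.
  - by move=> x y /= h; apply: le_anti; rewrite andbC.
  - apply/subsetP => _ /imsetP[S + ->]; rewrite inE => /andP[bS SX].
    rewrite in_setD1 inP //; last by apply/set0Pn; exists b.
    rewrite andbT; apply/eqP => /emb_inj e; move: bS; rewrite e ?proper_sub //.
    by rewrite !inE eqxx.
  - exact: sub0set.
  - move=> x /Pbs[S [-> S0 SX]]; rewrite fS; last exact: subset_trans (subsetUr _ _) (proper_sub SX).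
    by apply: imset_f; rewrite inE setU11.
  - move=> x /Pbs[S [-> S0 SX]]; have SX' := subset_trans (subsetUr _ _) (proper_sub SX).
    by rewrite fS // (emb _ _ SX' (proper_sub SX)) subsetUr.
  - move=> x /imsetP[S + ->]; rewrite inE => /andP[bS SX].
    rewrite fS ?proper_sub //; congr phi; apply/setUidPr; rewrite sub1set //.
  - move=> x y /Pbs[S [-> _ SX]] /Pbs[S' [-> _ S'X]].
    have SX' := subset_trans (subsetUr _ _) (proper_sub SX).
    have S'X' := subset_trans (subsetUr _ _) (proper_sub S'X).
    by rewrite !fS // (emb _ _ S'X' SX') (emb _ _ (proper_sub S'X) (proper_sub SX)) => h; apply: setUS.
  (* The image has the least element [phi [set b]], which belongs to the proper part because [X'] is
     not empty. *)
  - rewrite chains_dual setD0; apply: (@collapsible_chains_cone _ _ lexx P0 (phi [set b])).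
      apply: imset_f; rewrite inE set11 properEneq sub1set bX andbT.
      apply: contraNneq X'n0 => e; apply/eqP/setP => x; rewrite /X' -e !inE.
      by case: eqP.
    move=> x /imsetP[S + ->]; rewrite inE => /andP[bS SX].
    have b1X : [set b] \subset X by rewrite sub1set.
    by rewrite (emb _ _ b1X (proper_sub SX)) sub1set bS orbT.
(* An element comparable with the flag lies between two consecutive members: those of the smaller
   flag if it is below [s], otherwise [s] and [phi X]. In this form the flag can later be proved
   maximal in a larger poset. *)
- move=> x x0 xX cmp; have := cmp s (setU11 _ _); case/orP => [xs|sx].
    have [] := maxC' x x0 xs; first by move=> y yC; apply: cmp; exact: setU1r.
    move=> S [i [SX' iX' iS hx [h1 h2]]]; exists S, i; split=> //.
    - exact: subset_trans X'X.
    - exact: (subsetP X'X).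
    - split; first by case: h1 => [->|h]; [left|right; exact: setU1r].
      by right; case: h2 => [->|h]; [exact: setU11|exact: setU1r].
  exists X', b; split=> //; first by rewrite !inE eqxx.
  - by rewrite bX'.
  - by split; [right; exact: setU11 | left].
Qed.

End Boolean.

(** * Equivalence relations generated by a shelled family *)

Section PartitionLattice.
Variable T : finType.
Variable E : nat -> {set T}.
Implicit Types (x y z w : {set T * T}) (A B : {set T}).

Definition sq A : {set T * T} := setX A A.
Definition idrel : {set T * T} := [set p | p.1 == p.2].

Definition eqv x :=
  [&& [forall a, (a, a) \in x],
      [forall a, forall b, ((a, b) \in x) ==> ((b, a) \in x)] &
      [forall a, forall b, forall c, ((a, b) \in x) ==> ((b, c) \in x) ==> ((a, c) \in x)]].

Lemma eqvP x : reflect [/\ forall a, (a, a) \in x,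
    forall a b, (a, b) \in x -> (b, a) \in x &
    forall a b c, (a, b) \in x -> (b, c) \in x -> (a, c) \in x] (eqv x).
Proof.
apply: (iffP and3P) => -[h1 h2 h3]; split.
- by move=> a; exact: (forallP h1).
- by move=> a b; move/forallP/(_ a)/forallP/(_ b)/implyP: h2.
- move=> a b c; move/forallP/(_ a)/forallP/(_ b)/forallP/(_ c): h3.
  by move=> /implyP h /h /implyP.
- by apply/forallP.
- by apply/forallP => a; apply/forallP => b; apply/implyP; exact: h2.
- apply/forallP => a; apply/forallP => b; apply/forallP => c.
  by apply/implyP => h; apply/implyP; exact: h3.
Qed.

Lemma in_sq A a b : ((a, b) \in sq A) = (a \in A) && (b \in A).
Proof. by rewrite in_setX. Qed.

Lemma sqS A B : A \subset B -> sq A \subset sq B.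
Proof. by move=> AB; apply: setXS. Qed.

Lemma in_idrel a b : ((a, b) \in idrel) = (a == b).
Proof. by rewrite inE. Qed.

Lemma idrel_sub x : eqv x -> idrel \subset x.
Proof.
move=> /eqvP[r _ _]; apply/subsetP => -[a b]; rewrite in_idrel => /eqP ->; exact: r.
Qed.

Lemma sub_pairs x y : (forall a b, (a, b) \in x -> (a, b) \in y) -> x \subset y.
Proof. by move=> h; apply/subsetP => -[a b]; exact: h. Qed.

Definition edge j x : rel T :=
  fun a b => [exists i : 'I_j, [&& sq (E i) \subset x, a \in E i & b \in E i]].

(** An interior operator: for an equivalence relation [x], the greatest join of some of the first
    [j] atoms that lies below [x]. The identity relation is the empty join. *)
Definition generated j x : {set T * T} := [set p | connect (edge j x) p.1 p.2].

(** For an equivalence relation the reverse inclusion is automatic, so [x] is the join of the atoms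
    of index below [j] that it contains. *)
Definition elt j x := eqv x && (x \subset generated j x).

Lemma edgeP j x a b :
  reflect (exists i, [/\ i < j, sq (E i) \subset x, a \in E i & b \in E i]) (edge j x a b).
Proof.
apply: (iffP existsP) => [[i /and3P[? ? ?]]|[i [ij ? ? ?]]]; first by exists i.
by exists (Ordinal ij); apply/and3P.
Qed.

Lemma in_generated j x a b : ((a, b) \in generated j x) = connect (edge j x) a b.
Proof. by rewrite inE. Qed.

Lemma edge_csym j x : connect_sym (edge j x).
Proof.
apply: sym_connect_sym => a b; apply/edgeP/edgeP => -[i [? ? ? ?]]; by exists i.
Qed.

Lemma generated_eqv j x : eqv (generated j x).
Proof.
apply/eqvP; split=> [a|a b|a b c]; rewrite !in_generated //.
- by rewrite edge_csym.
- exact: connect_trans.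
Qed.

Lemma edge_sub j x a b : edge j x a b -> (a, b) \in x.
Proof.
by move=> /edgeP[i [_ /subsetP h aE bE]]; apply: h; rewrite in_sq aE.
Qed.

Lemma generated_sub j x : eqv x -> generated j x \subset x.
Proof.
move=> /eqvP[r s t]; apply: sub_pairs => a b; rewrite in_generated => /connectP[p].
elim: p a => [|c p IH] a /=; first by move=> _ ->.
by move=> /andP[/edge_sub ac /IH h] /h; exact: t.
Qed.

Lemma connect_edge j x j' x' :
  (forall i, i < j -> sq (E i) \subset x -> exists i', [/\ i' < j', sq (E i') \subset x' & E i \subset E i']) ->
  generated j x \subset generated j' x'.
Proof.
move=> h; apply: sub_pairs => a b; rewrite !in_generated.
apply: connect_sub => {}a {}b /edgeP[i [ij ix aE bE]].
have [i' [ij' ix' ii']] := h _ ij ix.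
by apply: connect1; apply/edgeP; exists i'; rewrite ij' ix' !(subsetP ii').
Qed.

Lemma generatedS j x y : x \subset y -> generated j x \subset generated j y.
Proof.
move=> xy; apply: connect_edge => i ij ix; exists i; split=> //; exact: subset_trans xy.
Qed.

Lemma sq_generated j x i : i < j -> sq (E i) \subset x -> sq (E i) \subset generated j x.
Proof.
move=> ij ix; apply: sub_pairs => a b; rewrite in_sq in_generated => /andP[aE bE].
by apply: connect1; apply/edgeP; exists i.
Qed.

Lemma generated_elt j x : elt j (generated j x).
Proof.
rewrite /elt generated_eqv; apply: connect_edge => i ij ix; exists i; split=> //; exact: sq_generated.
Qed.

Lemma elt_eqv j x : elt j x -> eqv x. Proof. by case/andP. Qed.

Lemma elt_generated j x : elt j x -> generated j x = x.
Proof. by move=> /andP[ex xs]; apply/eqP; rewrite eqEsubset xs generated_sub. Qed.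

Lemma elt_connect j x a b : elt j x -> (a, b) \in x -> connect (edge j x) a b.
Proof. by rewrite -in_generated => /elt_generated ->. Qed.

Lemma eltP j x : eqv x -> (forall a b, (a, b) \in x -> connect (edge j x) a b) -> elt j x.
Proof.
move=> ex h; rewrite /elt ex; apply: sub_pairs => a b; rewrite in_generated; exact: h.
Qed.

Lemma elt_widen j j' x : j <= j' -> elt j x -> elt j' x.
Proof.
move=> jj' /andP[ex xs]; rewrite /elt ex; apply: subset_trans xs _.
by apply: connect_edge => i ij ix; exists i; split=> //; exact: leq_trans jj'.
Qed.

Lemma elt_atom j x : elt j x -> idrel \proper x -> exists2 i, i < j & sq (E i) \subset x.
Proof.
move=> ex /properP[_ [[a b] abx]]; rewrite in_idrel => /negP ab.
case/connectP: (elt_connect ex abx) => -[|c p] /=; first by move=> _ e; case: ab; rewrite e.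
by move=> /andP[/edgeP[i [ij ix _ _]] _] _; exists i.
Qed.

Definition between j x y : {set {set T * T}} :=
  [set z | [&& elt j z, x \proper z & z \proper y]].

Lemma betweenP j x y z : reflect [/\ elt j z, x \proper z & z \proper y] (z \in between j x y).
Proof. by rewrite inE; apply: and3P. Qed.

Lemma between_widen j j' x y : j <= j' -> between j x y \subset between j' x y.
Proof.
by move=> jj'; apply/subsetP => z /betweenP[ez xz zy]; apply/betweenP; split=> //; exact: elt_widen ez.
Qed.

Definition sle x y := x \subset y.
Lemma sle_refl : reflexive sle. Proof. by move=> x; exact: subxx. Qed.
Lemma sle_trans : transitive sle. Proof. by move=> y x z; exact: subset_trans. Qed.
Lemma sle_anti : antisymmetric sle.
Proof. by move=> x y; rewrite /sle -eqEsubset => /eqP. Qed.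

(** * Critical chains of open intervals *)

Section Shelling.
Variable q : nat.

(* Maximality is asked in the lattice of all [q] atoms, so that these chains stay
   facets while atoms are added one by one. *)
Definition saturated (M : {set {set {set T * T}}}) x y :=
  forall C, C \in M -> forall z, z \in between q x y ->
    {in C, forall c, sle z c || sle c z} -> z \in C.

(** [M] collects the critical chains, each responsible for one sphere. It is empty when the chains
    collapse entirely, and consists of the empty chain for an empty interval. *)
Definition sphere_like (P : {set {set T * T}}) x y :=
  exists M : {set {set {set T * T}}}, [/\ M \subset chains sle P, saturated M x y &
                collapsible (chains sle P :\: M)].

Hypothesis E_gt1 : forall i, i < q -> 1 < #|E i|.
Hypothesis E_antichain : forall i j, i < q -> j < q -> E i \subset E j -> i = j.
Hypothesis E_shelling : forall i k, i < k -> k < q ->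
  exists j v, [/\ j < k, v \in E i, v \notin E k & E j :|: E k = v |: E k].

Lemma E_ex2 i a : i < q -> exists2 b, b \in E i & b != a.
Proof.
move=> /E_gt1; rewrite (cardsD1 a) => h.
have /card_gt0P[b] : 0 < #|E i :\ a|.
  by rewrite lt0n; apply: contraTneq h => ->; rewrite addn0; case: (a \in E i).
by rewrite !inE => /andP[ba bE]; exists b.
Qed.

Lemma E_ex i : i < q -> exists a, a \in E i.
Proof. by move=> /E_gt1 h; apply/card_gt0P; exact: leq_trans h. Qed.

(** Each point of [E i] has a distinct partner there, and the resulting off-diagonal pair can only
    come from [sq A]. *)
Lemma sq_inj i A : i < q -> sq (E i) \subset idrel :|: sq A -> E i \subset A.
Proof.
move=> iq /subsetP h; apply/subsetP => a aE; have [b bE ba] := E_ex2 a iq.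
have := h (a, b); rewrite in_sq aE bE in_setU in_idrel in_sq eq_sym (negbTE ba) /=.
by move=> /(_ isT)/andP[].
Qed.

Definition atom i := idrel :|: sq (E i).

Lemma atom_eqv i : eqv (atom i).
Proof.
apply/eqvP; split=> [a|a b|a b c]; rewrite !in_setU !in_idrel !in_sq ?eqxx //.
  by rewrite eq_sym (andbC (a \in _)).
by case/orP=> [/eqP ->//|/andP[aE bE]] /orP[/eqP <-|/andP[_ cE]]; rewrite ?aE ?bE ?cE ?orbT.
Qed.

Lemma atom_sub i x : eqv x -> sq (E i) \subset x -> atom i \subset x.
Proof. by move=> ex ix; rewrite subUset idrel_sub. Qed.

Lemma atom_elt i j : i < j -> elt j (atom i).
Proof.
move=> ij; apply: eltP; first exact: atom_eqv.
move=> a b; rewrite in_setU in_idrel in_sq => /orP[/eqP ->//|/andP[aE bE]].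
by apply: connect1; apply/edgeP; exists i; rewrite ij aE bE subsetUr.
Qed.

(** A nontrivial element contains some atom, and the antichain hypothesis turns inclusion between
    atoms into equality. *)
Lemma below_atom k x : k < q -> elt q x -> idrel \proper x -> x \subset atom k -> x = atom k.
Proof.
move=> kq ex dx xk; have [i iq ix] := elt_atom ex dx.
have ik := E_antichain iq kq (sq_inj iq (subset_trans ix xk)).
apply/eqP; rewrite eqEsubset xk /=; apply: atom_sub; first exact: elt_eqv ex.
by rewrite -ik.
Qed.

Lemma idrel_atom k : k < q -> idrel \proper atom k.
Proof.
move=> kq; apply/properP; split; first exact: subsetUl.
have [a aE] := E_ex kq; have [b bE ba] := E_ex2 a kq.
by exists (a, b); rewrite ?in_idrel 1?eq_sym // in_setU in_sq aE bE orbT.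
Qed.

(** * One more atom: relations in which it is a block *)

Section Step.
Variable k : nat.
Hypothesis kq : k < q.

(** The points [v] by which a single earlier atom enlarges [E k]. As [E j] has at least two points,
    it consists of [v] and at least one point of [E k]. *)
Definition nbrs : {set T} := [set v | (v \notin E k) &&
  [exists j : 'I_k, E j :|: E k == v |: E k]].

Definition touched z : {set T} := [set v in nbrs | [exists a in E k, (a, v) \in z]].

(** Only closedness of [E k] under [z] is asked; together with [sq (E k) \subset z] it says that
    [E k] is a class of [z]. *)
Definition is_block z := forall a b, a \in E k -> (a, b) \in z -> b \in E k.

Lemma touchedP z v : reflect (v \in nbrs /\ exists2 a, a \in E k & (a, v) \in z) (v \in touched z).
Proof.
apply: (iffP setIdP) => -[vn h]; split=> //; first exact/exists_inP.
by apply/exists_inP.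
Qed.

Lemma nbrsN v : v \in nbrs -> v \notin E k.
Proof. by rewrite inE => /andP[]. Qed.

Lemma touchedS z z' : z \subset z' -> touched z \subset touched z'.
Proof.
move=> /subsetP zz'; apply/subsetP => v /touchedP[vn [a aE av]].
by apply/touchedP; split=> //; exists a => //; exact: zz'.
Qed.

(* A path of edges leaving [E k] uses some [E i], [i < k], meeting both [E k]
   and its complement; the shelling puts a point of [nbrs] into that [E i]. *)
Lemma is_block_touched z : elt k.+1 z -> sq (E k) \subset z -> touched z = set0 -> is_block z.
Proof.
move=> ez kz t0 a b aE ab; have := elt_connect ez ab.
have cl : closed (edge k.+1 z) (mem (E k)).
  apply: intro_closed; first exact: edge_csym.
  move=> c d /edgeP[i [ik iz ci di]] ck; apply/negPn/negP => dk.
  move: ik; rewrite ltnS leq_eqVlt => /orP[/eqP e|ik]; first by rewrite -e di in dk.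
  have [j [v [jk vi vk jv]]] := E_shelling ik kq.
  have : v \in touched z.
    apply/touchedP; split; last by exists c => //; apply: (subsetP iz); rewrite in_sq ci.
    by rewrite inE vk; apply/existsP; exists (Ordinal jk); apply/eqP.
  by rewrite t0 inE.
move=> /(closed_connect cl) h; rewrite -[b \in E k]/(b \in mem (E k)) -h; exact: aE.
Qed.

(** Dissolves the block [E k] into singletons. On equivalence relations with the block [E k] it is
    inverse to [attach], which starts from those in which every point of [E k] is isolated
    ([off]). *)
Definition detach z := (z :\: sq (E k)) :|: idrel.
Definition attach z := z :|: sq (E k).

Lemma in_detach z a b : ((a, b) \in detach z) =
  ~~ ((a \in E k) && (b \in E k)) && ((a, b) \in z) || (a == b).
Proof. by rewrite in_setU in_setD in_sq in_idrel. Qed.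

Lemma detach_eqv z : eqv z -> is_block z -> eqv (detach z).
Proof.
move=> /eqvP[r s t] iz; apply/eqvP; split=> [a|a b|a b c]; rewrite !in_detach ?eqxx ?orbT //.
  by rewrite (andbC (b \in _)) (eq_sym b) => /orP[/andP[-> /s ->]//|->]; rewrite orbT.
move=> /orP[/andP[h ab]|/eqP ->//] /orP[/andP[h' bc]|/eqP <-]; last by rewrite h ab.
rewrite (t _ _ _ ab bc) andbT; apply/orP; left.
apply: contra h => /andP[aE _]; by rewrite aE (iz _ _ aE ab).
Qed.

(** Since [E k] is a block, a path starting outside it uses only atoms disjoint from it. These
    survive the detaching, and [E k] is not among them, so the index [k] may be dropped. *)
Lemma detach_elt j j' z : j <= q -> (forall i, i < j -> i != k -> i < j') ->
  elt j z -> sq (E k) \subset z -> is_block z -> elt j' (detach z).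
Proof.
move=> jq jj' ez kz iz; have /eqvP[r s t] := elt_eqv ez.
apply: eltP; first by apply: detach_eqv => //; exact: elt_eqv ez.
move=> a b; rewrite in_detach => /orP[/andP[h ab]|/eqP ->//].
have aE : a \notin E k.
  by apply: contra h => aE; rewrite aE (iz _ _ aE ab).
case/connectP: (elt_connect ez ab) => p pp ->.
elim: p a aE pp {h ab} => [|c p IH] a aE //= /andP[/edgeP[i [ij i_z ai ci]] pp].
have nk : i != k by apply: contraNneq aE => <-.
have disj d : d \in E i -> d \notin E k.
  move=> di; apply/negP => dE; case/negP: aE; apply: (iz d) => //.
  by apply: (subsetP i_z); rewrite in_sq di.
apply: connect_trans (IH c (disj _ ci) pp); apply: connect1; apply/edgeP; exists i; split=> //.
  exact: jj'.
apply: sub_pairs => d d'; rewrite in_sq => /andP[di di']; rewrite in_detach (negbTE (disj _ di)) /=.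
by rewrite (subsetP i_z) // in_sq di.
Qed.

Lemma attach_detach z : eqv z -> sq (E k) \subset z -> attach (detach z) = z.
Proof.
move=> /eqvP[r _ _] kz; apply/eqP; rewrite eqEsubset; apply/andP; split; apply: sub_pairs => a b.
  rewrite in_setU in_detach => /orP[/orP[/andP[_ ->]//|/eqP ->//]|]; exact: (subsetP kz).
by rewrite in_setU in_detach in_sq => ->; rewrite andbT orbAC orNb.
Qed.

Definition off z := forall a b, a \in E k -> (a, b) \in z -> a = b.

Lemma off_sub x z : x \subset z -> off z -> off x.
Proof. by move=> /subsetP xz oz a b aE /xz; exact: oz. Qed.

Lemma detach_off z : is_block z -> off (detach z).
Proof.
move=> iz a b aE; rewrite in_detach aE /= => /orP[/andP[nb ab]|/eqP//].
by rewrite (iz _ _ aE ab) in nb.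
Qed.

Lemma detach_attach z : eqv z -> off z -> detach (attach z) = z.
Proof.
move=> /eqvP[r _ _] oz; apply/eqP; rewrite eqEsubset; apply/andP; split; apply: sub_pairs => a b.
  rewrite in_detach in_setU in_sq => /orP[/andP[h /orP[//|h']]|/eqP ->//].
  by rewrite h' in h.
rewrite in_detach in_setU in_sq => h; rewrite h /= andbT.
case: (boolP (a \in E k)) => //= aE; by rewrite (oz _ _ aE h) eqxx orbT.
Qed.

Lemma attach_eqv z : eqv z -> off z -> eqv (attach z).
Proof.
move=> /eqvP[r s t] oz.
have oz' a b : b \in E k -> (a, b) \in z -> a = b by move=> bE /s /(oz _ _ bE).
apply/eqvP; split=> [a|a b|a b c]; rewrite !in_setU !in_sq ?r //.
  by rewrite andbC => /orP[/s ->|->]; rewrite ?orbT.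
case/orP=> [ab|/andP[aE bE]] /orP[bc|/andP[bE' cE]].
- by rewrite (t _ _ _ ab bc).
- by rewrite (oz' _ _ bE' ab) bE' cE orbT.
- by rewrite -(oz _ _ bE bc) aE bE orbT.
- by rewrite aE cE orbT.
Qed.

Lemma attach_elt z : elt k z -> off z -> elt k.+1 (attach z).
Proof.
move=> ez oz; apply: eltP; first by apply: attach_eqv => //; exact: elt_eqv ez.
have zs : z \subset attach z by exact: subsetUl.
move=> a b; rewrite in_setU in_sq => /orP[ab|/andP[aE bE]]; last first.
  by apply: connect1; apply/edgeP; exists k; rewrite ltnSn subsetUr.
rewrite -in_generated; have /subsetP h := generatedS k.+1 zs; apply: h.
by rewrite (elt_generated (elt_widen (leqnSn k) ez)).
Qed.

Lemma atom_sq z : atom k \subset z -> sq (E k) \subset z.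
Proof. by apply: subset_trans; exact: subsetUr. Qed.

Lemma detachS z z' : z \subset z' -> detach z \subset detach z'.
Proof. by move=> zz'; apply: setSU; apply: setSD. Qed.

Lemma attachS z z' : z \subset z' -> attach z \subset attach z'.
Proof. exact: setSU. Qed.

Lemma detach_sub_inv z z' : eqv z' -> sq (E k) \subset z' -> detach z \subset detach z' -> z \subset z'.
Proof.
move=> ez kz' /attachS; rewrite (attach_detach ez kz'); apply: subset_trans.
apply: sub_pairs => a b ab; rewrite in_setU in_detach in_sq ab andbT.
by rewrite orbAC orNb.
Qed.

(** Used twice: with [k.+1] and [k] for the isomorphism of intervals, and with [q] on both sides to
    carry saturation over. *)
Lemma detach_between j j' z w : j <= q -> (forall i, i < j -> i != k -> i < j') ->
  eqv w -> is_block w ->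
  z \in between j (atom k) w -> detach z \in between j' idrel (detach w).
Proof.
move=> jq jj' ew iw /betweenP[ez kz zw].
have kz' : sq (E k) \subset z by apply: atom_sq; exact: proper_sub.
have iz : is_block z by move=> a b aE /(subsetP (proper_sub zw)); exact: iw.
have kw : sq (E k) \subset w := subset_trans kz' (proper_sub zw).
apply/betweenP; split; first exact: detach_elt ez kz' iz.
- rewrite properE subsetUr /=; apply/negP => h.
  case/andP: kz => _ /negP; apply; rewrite -(attach_detach (elt_eqv ez) kz').
  exact: setSU.
- rewrite properE (detachS (proper_sub zw)) /=; apply/negP => /(detach_sub_inv (elt_eqv ez) kz').
  by case/andP: zw => _ /negP.
Qed.

Lemma attach_between x w : eqv w -> sq (E k) \subset w -> is_block w ->
  x \in between k idrel (detach w) -> attach x \in between k.+1 (atom k) w.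
Proof.
move=> ew kw iw /betweenP[ex dx xw].
have ox : off x := off_sub (proper_sub xw) (detach_off iw).
have exq := elt_eqv ex.
apply/betweenP; split; first exact: attach_elt.
- rewrite properE; apply/andP; split; first by apply: setSU; exact: idrel_sub.
  apply/negP => /detachS; rewrite detach_attach // => h.
  case/andP: dx => _ /negP; apply; apply: subset_trans h _.
  apply: sub_pairs => a b; rewrite in_detach in_setU in_idrel in_sq.
  by case: (a == b); rewrite ?orbT //= orbF andNb.
- rewrite properE -{1}(attach_detach ew kw) (attachS (proper_sub xw)) /=; apply/negP => /detachS.
  by rewrite detach_attach //; case/andP: xw => _ /negP.
Qed.

(** [attach] and [detach] are inverse isomorphisms between the interval from the identity to
    [detach w], built from the first [k] atoms only, and the interval from [atom k] to [w]. Chains,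
    critical chains and collapses are carried across. *)
Lemma sphere_like_attach w : elt k.+1 w -> sq (E k) \subset w -> is_block w ->
  sphere_like (between k idrel (detach w)) idrel (detach w) ->
  sphere_like (between k.+1 (atom k) w) (atom k) w.
Proof.
move=> ew kw iw [M [MC satM cM]]; have ewq := elt_eqv ew.
pose h (C : {set {set T * T}}) := attach @: C.
have offC (x : {set T * T}) : x \in between k idrel (detach w) -> eqv x /\ off x.
  move=> /betweenP[ex dx xw]; split; first exact: elt_eqv ex.
  exact: off_sub (proper_sub xw) (detach_off iw).
have dK x : x \in between k idrel (detach w) -> detach (attach x) = x.
  by move=> /offC[ex ox]; exact: detach_attach.
have aK z : z \in between k.+1 (atom k) w -> attach (detach z) = z.
  move=> /betweenP[ez /proper_sub kz _]; apply: attach_detach; [exact: elt_eqv ez|exact: atom_sq].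
have jj' i : i < k.+1 -> i != k -> i < k by rewrite ltnS ltn_neqAle => -> ->.
have dI z : z \in between k.+1 (atom k) w -> detach z \in between k idrel (detach w).
  by apply: detach_between.
have hin (C : {set {set T * T}}) : C \in chains sle (between k idrel (detach w)) -> {subset C <= between k idrel (detach w)}.
  by case/chainsP => /subsetP.
have hK (C : {set {set T * T}}) : C \in chains sle (between k idrel (detach w)) -> detach @: h C = C.
  move=> /hin CP; rewrite /h -imset_comp -[RHS]imset_id; apply: eq_in_imset => x /CP /dK //.
have himg : chains sle (between k.+1 (atom k) w) = h @: chains sle (between k idrel (detach w)).
  apply/setP => C; apply/idP/imsetP.
    move=> /chainsP[/subsetP CP Cch]; exists (detach @: C); last first.
      by rewrite /h -imset_comp -[LHS]imset_id; apply: eq_in_imset => z /CP /aK /= ->.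
    apply/chainsP; split.
      by apply/subsetP => _ /imsetP[z /CP /dI zI ->].
    by move=> _ _ /imsetP[z zC ->] /imsetP[z' zC' ->]; case/orP: (Cch _ _ zC zC') => le;
      rewrite /sle (detachS le) ?orbT.
  move=> [D /chainsP[/subsetP DP Dch] ->]; apply/chainsP; split.
    by apply/subsetP => _ /imsetP[z /DP zI ->]; exact: attach_between.
  by move=> _ _ /imsetP[z zC ->] /imsetP[z' zC' ->]; case/orP: (Dch _ _ zC zC') => le;
      rewrite /sle (attachS le) ?orbT.
have hinj : {in chains sle (between k idrel (detach w)) &, injective h}.
  by move=> C D /hK {2}<- /hK {2}<- ->.
exists (h @: M); split.
- by rewrite himg; exact: imsetS.
- move=> _ /imsetP[C CM ->] z zI cmp.
  have dz : detach z \in between q idrel (detach w).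
    by apply: detach_between zI.
  have ez : attach (detach z) = z.
    by case/betweenP: zI => ez /proper_sub kz _; apply: attach_detach; [exact: elt_eqv ez|exact: atom_sq].
  rewrite -ez; apply: imset_f; apply: satM => // c cC.
  have := cmp _ (imset_f _ cC); have cI : c \in between k idrel (detach w).
    by apply: hin cC; exact: (subsetP MC).
  by rewrite /sle => /orP[] /detachS; rewrite dK // => ->; rewrite ?orbT.
- have -> : chains sle (between k.+1 (atom k) w) :\: h @: M
            = h @: (chains sle (between k idrel (detach w)) :\: M).
    rewrite himg; apply/setP => C; rewrite in_setD; apply/andP/imsetP.
      move=> [CM /imsetP[D DP CE]]; exists D => //; rewrite in_setD DP andbT.
      by apply: contra CM => DM; rewrite CE; exact: imset_f.
    move=> [D]; rewrite in_setD => /andP[DM DP] ->; split; last exact: imset_f.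
    apply: contra DM => /imsetP[D' D'M e].
    by rewrite (hinj _ _ DP (subsetP MC _ D'M) e).
  apply: (@collapsible_map _ _ h attach) => //.
    move=> C D; rewrite !in_setD => /andP[_ CP] /andP[_ DP] s.
    by rewrite -(hK _ CP) -(hK _ DP); exact: imsetS.
  move=> C x; rewrite !in_setD => /andP[_ CP] /andP[_ xCP] xC; split; first by rewrite /h imsetU1.
  apply: contra xC => /imsetP[y yC e].
  have yI := hin _ CP _ yC; have xI := hin _ xCP _ (setU11 _ _).
  by rewrite -(dK _ xI) e dK.
Qed.

(** * Growing the block of the new atom *)

Section Merge.
Variables (w y : {set T * T}).
Implicit Types (S N : {set {set T}}).
Hypotheses (ew : elt k.+1 w) (kw : sq (E k) \subset w) (iw : is_block w).
Hypotheses (ey : elt k.+1 y) (wy : w \proper y) (ty : touched y != set0).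

Definition cls v : {set T} := [set b | (v, b) \in w].
Definition touched_cls z : {set {set T}} := cls @: touched z.
(** Glues to [E k] the blocks of [w] listed in [S]. For [S] inside [touched_cls y] these relations
    form a Boolean lattice with bottom [w]. *)
Definition merge (S : {set {set T}}) : {set T * T} := w :|: sq (E k :|: cover S).

Let X := touched_cls y.
Let wr : forall a, (a, a) \in w. Proof. by have /eqvP[] := elt_eqv ew. Qed.
Let wsym : forall a b, (a, b) \in w -> (b, a) \in w. Proof. by have /eqvP[] := elt_eqv ew. Qed.
Let wtr : forall a b c, (a, b) \in w -> (b, c) \in w -> (a, c) \in w.
Proof. by have /eqvP[] := elt_eqv ew. Qed.

Lemma cls_eq u v : (u, v) \in w -> cls u = cls v.
Proof.
move=> uv; apply/setP => b; rewrite !inE; apply/idP/idP => h.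
  exact: wtr (wsym uv) h.
exact: wtr uv h.
Qed.

Lemma coverP (S : {set {set T}}) b : S \subset X ->
  reflect (exists v, [/\ v \in touched y, cls v \in S & (v, b) \in w]) (b \in cover S).
Proof.
move=> SX; apply: (iffP bigcupP) => [[B BS bB]|[v [vy vS vb]]].
  have /imsetP[v vy e] := subsetP SX _ BS; exists v; rewrite -e; split=> //.
  by move: bB; rewrite e inE.
by exists (cls v) => //; rewrite inE.
Qed.

Lemma in_merge S a b : ((a, b) \in merge S) =
  ((a, b) \in w) || (a \in E k :|: cover S) && (b \in E k :|: cover S).
Proof. by rewrite [LHS]in_setU in_sq. Qed.

Lemma merge_closed S a b : S \subset X -> (a, b) \in w ->
  a \in E k :|: cover S -> b \in E k :|: cover S.
Proof.
move=> SX ab; rewrite !in_setU => /orP[aE|/(coverP _ SX) [v [vy vS va]]].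
  by rewrite (iw aE ab).
by apply/orP; right; apply/(coverP _ SX); exists v; split=> //; exact: wtr va ab.
Qed.

Lemma merge_eqv S : S \subset X -> eqv (merge S).
Proof.
move=> SX; apply/eqvP; split=> [a|a b|a b c]; rewrite !in_merge ?wr //.
  by rewrite andbC => /orP[/wsym ->|->]; rewrite ?orbT.
case/orP=> [ab|/andP[aD bD]] /orP[bc|/andP[bD' cD]].
- by rewrite (wtr ab bc).
- by rewrite cD (merge_closed SX (wsym ab) bD') orbT.
- by rewrite aD (merge_closed SX bc bD) orbT.
- by rewrite aD cD orbT.
Qed.

(** A block in [S] contains a neighbour [v], and the earlier atom witnessing this links [v] to [E k]
    without leaving [v |: E k]. *)
Lemma merge_elt S : S \subset X -> elt k.+1 (merge S).
Proof.
move=> SX; apply: eltP; first exact: merge_eqv.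
have /subsetP wS := generatedS k.+1 (subsetUl w (sq (E k :|: cover S))).
have conn_w a b : (a, b) \in w -> connect (edge k.+1 (merge S)) a b.
  by rewrite -in_generated => ab; apply: wS; rewrite (elt_generated ew).
have sqD i a b : i < k.+1 -> E i \subset E k :|: cover S -> a \in E i -> b \in E i ->
    connect (edge k.+1 (merge S)) a b.
  move=> ik iD aE bE; apply: connect1; apply/edgeP; exists i; split=> //.
  by apply: subset_trans (subsetUr _ _); exact: sqS.
have [e eE] := E_ex kq.
have to_e a : a \in E k :|: cover S -> connect (edge k.+1 (merge S)) a e.
  rewrite in_setU => /orP[aE|aS]; first by apply: (sqD k) => //; exact: subsetUl.
  case/(coverP _ SX): (aS) => v [vy vS va].
  apply: connect_trans (conn_w _ _ (wsym va)) _.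
  case/touchedP: (vy); rewrite inE => /andP[vE /existsP[[j jk] /= /eqP jv]] _.
  have jq : j < q := ltn_trans jk kq.
  have vEj : v \in E j by have := setU11 v (E k); rewrite -jv in_setU (negbTE vE) orbF.
  have jD : E j \subset E k :|: cover S.
    apply: subset_trans (subsetUl _ (E k)) _; rewrite jv subUset sub1set subsetUl andbT.
    by rewrite in_setU; apply/orP; right; apply/(coverP _ SX); exists v.
  have [b bE bv] := E_ex2 v jq.
  have bk : b \in E k.
    have: b \in v |: E k by rewrite -jv in_setU bE.
    by rewrite in_setU1 (negbTE bv).
  apply: (@connect_trans _ _ b); first by apply: (sqD j) => //; exact: ltnW.
  by apply: (sqD k) => //; exact: subsetUl.
move=> a b; rewrite in_merge => /orP[/conn_w //|/andP[/to_e ae /to_e be]].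
by apply: connect_trans ae _; rewrite edge_csym.
Qed.

Lemma merge_embed (S S' : {set {set T}}) : S \subset X -> S' \subset X ->
  sle (merge S) (merge S') = (S \subset S').
Proof.
move=> SX S'X; apply/idP/idP => [/subsetP h|h]; last first.
  apply: setUS; apply: sqS; apply: setUS.
  by apply/bigcupsP => B BS; apply: bigcup_sup; exact: (subsetP h).
apply/subsetP => B BS; have /imsetP[v vy e] := subsetP SX _ BS.
have [a aE] := E_ex kq; have /touchedP[/nbrsN vE _] := vy.
have := h (a, v); rewrite !in_merge !in_setU aE (negbTE vE) /=.
have -> /= : v \in cover S by apply/(coverP _ SX); exists v; rewrite wr -e.
rewrite orbT => /(_ isT) /orP[/(iw aE)|]; first by rewrite (negbTE vE).
by move=> /(coverP _ S'X) [v' [_ v'S /cls_eq v'v]]; rewrite e -v'v.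
Qed.

(** Everything merged is already related in [z] to a point of [E k]. Hence passing from [z] to the
    merge of its touched classes is a decreasing map. *)
Lemma merge_sub z : eqv z -> w \subset z -> merge (touched_cls z) \subset z.
Proof.
move=> /eqvP[r s t] wz; have [e eE] := E_ex kq.
have to_e a : a \in E k :|: cover (touched_cls z) -> (e, a) \in z.
  rewrite in_setU => /orP[aE|/bigcupP[B /imsetP[v /touchedP[_ [b bE bv]] ->]]].
    by apply: (subsetP wz); apply: (subsetP kw); rewrite in_sq eE.
  rewrite inE => /(subsetP wz) va; apply: (t _ _ _ _ va); apply: (t _ _ _ _ bv).
  by apply: (subsetP wz); apply: (subsetP kw); rewrite in_sq eE.
apply: sub_pairs => a b; rewrite in_merge => /orP[/(subsetP wz) //|/andP[/to_e ea /to_e]].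
exact: t (s _ _ ea).
Qed.

Lemma touched_clsS z z' : z \subset z' -> touched_cls z \subset touched_cls z'.
Proof. by move=> zz'; apply: imsetS; exact: touchedS. Qed.

Lemma touched_merge S : S \subset X -> touched_cls (merge S) = S.
Proof.
move=> SX; apply/setP => B; apply/imsetP/idP.
  move=> [v /touchedP[vn [a aE av]] ->]; move: av; rewrite in_merge => /orP[/(iw aE)|/andP[_]].
    by rewrite (negbTE (nbrsN vn)).
  rewrite in_setU (negbTE (nbrsN vn)) /= => /(coverP _ SX) [v' [_ v'S /cls_eq <-]] //.
move=> BS; have /imsetP[v vy e] := subsetP SX _ BS; exists v => //.
have /touchedP[vn _] := vy; have [a aE] := E_ex kq.
apply/touchedP; split=> //; exists a => //; rewrite in_merge !in_setU aE /=.
have -> : v \in cover S by apply/(coverP _ SX); exists v; rewrite -e wr.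
by rewrite !orbT.
Qed.

Lemma merge0 : merge set0 = w.
Proof. by rewrite /merge /cover big_set0 setU0; apply/setUidPl. Qed.

(** Either [x] relates [E k] to the block [B], and then contains the whole larger merge, or it
    relates no point of [B] to the block grown so far. So no equivalence relation lies strictly
    between consecutive merges, which makes flags of merges maximal in the lattice of all [q]
    atoms. *)
Lemma merge_cover S B x : S \subset X -> B \in X -> eqv x ->
  merge S \subset x -> x \subset merge (B |: S) -> x = merge S \/ x = merge (B |: S).
Proof.
move=> SX /imsetP[v vy Be] /eqvP[r s t] Sx xS; have [e eE] := E_ex kq.
have wx : w \subset x := subset_trans (subsetUl _ _) Sx.
have cB b : (b \in E k :|: cover (B |: S)) = ((v, b) \in w) || (b \in E k :|: cover S).
  by rewrite /cover bigcup_setU big_set1 !in_setU Be inE orbCA.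
have De d : d \in E k :|: cover S -> (e, d) \in x.
  by move=> dD; apply: (subsetP Sx); rewrite in_merge dD in_setU eE orbT.
have [ev|ev] := boolP ((e, v) \in x); [right|left]; apply/eqP; rewrite eqEsubset ?Sx ?xS ?andbT /=.
  have eD b : b \in E k :|: cover (B |: S) -> (e, b) \in x.
    by rewrite cB => /orP[/(subsetP wx)|/De //]; exact: t ev.
  apply: sub_pairs => a b; rewrite in_merge => /orP[/(subsetP wx) //|/andP[/eD ea /eD eb]].
  exact: t (s _ _ ea) eb.
have no a b : (a, b) \in x -> a \in E k :|: cover S -> (v, b) \in w -> False.
  move=> ab /De ea vb; case/negP: ev; apply: (t _ _ _ ea); apply: (t _ _ _ ab).
  by apply: s; exact: (subsetP wx).
apply: sub_pairs => a b ab; have := subsetP xS _ ab; rewrite !in_merge => /orP[->//|].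
rewrite !cB => /andP[/orP[va|aD] /orP[vb|bD]].
- by rewrite (wtr (wsym va) vb).
- by case: (no _ _ (s _ _ ab) bD va).
- by case: (no _ _ ab aD vb).
- by rewrite aD bD orbT.
Qed.

Definition touching : {set {set T * T}} := [set z in between k.+1 w y | touched z != set0].

(** The decreasing map [g] retracts [touching] onto the merges in it. If [merge X] is strictly below
    [y], it is their greatest element and everything collapses; if it equals [y], what remains is
    the proper part of the lattice of subsets of [X]. *)
Lemma sphere_like_touching : sphere_like touching w y.
Proof.
pose g z := merge (touched_cls z).
have X0 : X != set0.
  by have /set0Pn[v vy] := ty; apply/set0Pn; exists (cls v); exact: imset_f.
have tcX z : z \in touching -> touched_cls z \subset X.
  by move=> /setIdP[/betweenP[_ _ /proper_sub zy] _]; exact: touched_clsS.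
have tc0 z : z \in touching -> touched_cls z != set0.
  move=> /setIdP[_ /set0Pn[v vz]]; apply/set0Pn; exists (cls v); exact: imset_f.
have gz z : z \in touching -> g z \subset z.
  by move=> /setIdP[/betweenP[ez /proper_sub wz _] _]; apply: merge_sub => //; exact: elt_eqv ez.
have touching_merge S : S \subset X -> S != set0 -> merge S \proper y -> merge S \in touching.
  move=> SX S0 Sy; apply/setIdP; split.
    apply/betweenP; split=> //; first exact: merge_elt.
    rewrite properE subsetUl /= -{1}merge0; have := merge_embed SX (sub0set _).
    by rewrite /sle => ->; rewrite subset0.
  apply: contraNneq S0 => e.
  by rewrite -(touched_merge SX) /touched_cls e imset0.
have Xy : merge X \subset y.
  by apply: merge_sub; [exact: elt_eqv ey|exact: proper_sub].
pose P0 := [set z in touching | g z == z].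
have retract (N : {set {set {set T * T}}}) : N \subset chains sle P0 -> collapsible (chains sle P0 :\: N) ->
    collapsible (chains sle touching :\: N).
  move=> NP; apply: (@collapsible_retract _ _ sle_refl sle_trans sle_anti _ _ g) => //.
  - by apply/subsetP => z /setIdP[].
  - move=> z zt; apply/setIdP; split; last by rewrite /g touched_merge // tcX.
    apply: touching_merge; rewrite ?tcX ?tc0 //.
    case/setIdP: (zt) => /betweenP[_ _ zy] _; exact: sub_proper_trans (gz _ zt) zy.
  - by move=> z /setIdP[_ /eqP].
  - move=> z z' zt z't zz'; rewrite merge_embed ?tcX //; exact: touched_clsS.
have [gy|gy] := eqVneq (merge X) y; last first.
  exists set0; split; [exact: sub0set|by move=> C; rewrite in_set0|].
  apply: retract; first exact: sub0set.
  have Xp : merge X \proper y by rewrite properEneq gy.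
  rewrite setD0; apply: (@collapsible_chains_cone _ _ sle_refl _ (merge X)).
    apply/setIdP; split; first exact: touching_merge.
    by rewrite /g touched_merge.
  move=> z /setIdP[zt /eqP e]; apply/orP; left; rewrite -e.
  by rewrite merge_embed ?subxx ?tcX.
have P0E : P0 = proper_subsets merge X.
  apply/setP => z; apply/setIdP/imsetP.
    move=> [zt /eqP e]; exists (touched_cls z) => //.
    rewrite inE tc0 // properEneq tcX // andbT.
    case/setIdP: zt => /betweenP[_ _ zy] _; apply: contraTneq zy => e'.
    by rewrite -e /g e' gy properxx.
  move=> [S]; rewrite inE => /andP[S0 SX] ->; have SX' := proper_sub SX.
  split; last by rewrite /g touched_merge.
  apply: touching_merge => //; rewrite -gy properE.
  have := merge_embed SX' (subxx X); have := merge_embed (subxx X) SX'; rewrite /sle => -> ->.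
  by move: SX; rewrite properE.
have [C [CP cC maxC]] := collapsible_boolean sle_refl sle_trans sle_anti X0 merge_embed.
exists [set C]; split.
- rewrite sub1set; case/chainsP: CP => h1 h2; apply/chainsP; split=> //.
  apply: subset_trans h1 _; rewrite -P0E; by apply/subsetP => z /setIdP[].
(* An element comparable with the flag lies between consecutive merges, so by [merge_cover] it is
   one of the two; being strictly between [w] and [y], it belongs to the flag. *)
- move=> C'; rewrite inE => /eqP -> x /betweenP[ex wx xy] cmp.
  have := maxC x; rewrite merge0 gy => /(_ (proper_sub wx) (proper_sub xy)).
  case=> [|S [B [SX BX _ [h1 h2] [h3 h4]]]]; first exact: cmp.
  case: (merge_cover SX BX (elt_eqv ex) h1 h2) => e.
    case: h3 => [S0|]; last by rewrite e.
    by move: wx; rewrite e S0 merge0 properxx.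
  case: h4 => [SB|]; last by rewrite e.
  by move: xy; rewrite e SB gy properxx.
- by apply: retract; rewrite ?P0E // sub1set.
Qed.

End Merge.

(** * The inductive step on the number of atoms *)

Lemma detach_proper z : eqv z -> sq (E k) \subset z -> atom k \proper z -> idrel \proper detach z.
Proof.
move=> ez kz kz'; rewrite properE subsetUr /=; apply/negP => h.
case/andP: kz' => _ /negP; apply; rewrite -(attach_detach ez kz); exact: setSU.
Qed.

Lemma atom_is_block : is_block (atom k).
Proof.
by move=> a b aE; rewrite in_setU in_idrel in_sq => /orP[/eqP <-|/andP[]].
Qed.

Hypothesis IH : forall x, elt k x -> idrel \proper x -> sphere_like (between k idrel x) idrel x.

Lemma sphere_like_block w : elt k.+1 w -> atom k \proper w -> is_block w ->
  sphere_like (between k.+1 (atom k) w) (atom k) w.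
Proof.
move=> ew kw iw; have kw' := atom_sq (proper_sub kw).
apply: sphere_like_attach => //; apply: IH; last by apply: detach_proper => //; exact: elt_eqv ew.
apply: (detach_elt _ _ ew) => // i; by rewrite ltnS ltn_neqAle => -> ->.
Qed.

(** If [y] touches a neighbour, [W] holds the elements in which [E k] is still a block. A critical
    chain with greatest element [w] in [W] consists of [w], a critical chain of the interval below
    it, known by detaching, and a critical chain of the touching elements above it. *)
Lemma sphere_like_above y : elt k.+1 y -> atom k \proper y ->
  sphere_like (between k.+1 (atom k) y) (atom k) y.
Proof.
move=> ey ky; have [ty|ty] := eqVneq (touched y) set0.
  apply: sphere_like_block => //; apply: is_block_touched => //.
  exact: atom_sq (proper_sub ky).
pose W := [set w in between k.+1 (atom k) y | touched w == set0].
have WP w : w \in W -> [/\ elt k.+1 w, atom k \proper w, w \proper y & is_block w].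
  move=> /setIdP[/betweenP[ew kw wy] /eqP tw]; split=> //.
  by apply: is_block_touched => //; exact: atom_sq (proper_sub kw).
have /fin_all_exists[NL hL] : forall w, exists N : {set {set {set T * T}}}, w \in W ->
    [/\ N \subset chains sle (between k.+1 (atom k) w), saturated N (atom k) w &
        collapsible (chains sle (between k.+1 (atom k) w) :\: N)].
  move=> w; have [wW|wW] := boolP (w \in W); last by exists set0.
  by have [ew kw _ iw] := WP _ wW; have [N hN] := sphere_like_block ew kw iw; exists N.
have /fin_all_exists[NU hU] : forall w, exists N : {set {set {set T * T}}}, w \in W ->
    [/\ N \subset chains sle (touching w y), saturated N w y &
        collapsible (chains sle (touching w y) :\: N)].
  move=> w; have [wW|wW] := boolP (w \in W); last by exists set0.
  have [ew kw wy iw] := WP _ wW.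
  have [N hN] := sphere_like_touching ew (atom_sq (proper_sub kw)) iw ey wy ty.
  by exists N.
(* Chains that miss [W] consist of touching elements only; they are governed by the same lemma with
   [atom k] in the role of [w]. *)
have [N0 [N0C sat0 c0]] := sphere_like_touching (atom_elt (ltnSn k))
  (atom_sq (subxx _)) atom_is_block ey ky ty.
set R := between k.+1 (atom k) y.
have WR : W \subset R by apply/subsetP => w /setIdP[].
have Wdown z w : z \in R -> w \in W -> sle z w -> z \in W.
  move=> zR /setIdP[_ /eqP tw] /touchedS; rewrite tw subset0 => tz.
  by apply/setIdP.
have RW : R :\: W = touching (atom k) y.
  apply/setP => z; rewrite in_setD [z \in W]inE [z \in touching _ _]inE.
  by case: (z \in R) => //=; rewrite ?andbT ?andbF.
have belowE w : w \in W -> [set z in W | sle z w & z != w] = between k.+1 (atom k) w.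
  move=> wW; have [ew kw wy iw] := WP _ wW; apply/setP => z; apply/setIdP/betweenP.
    move=> [/WP[ez kz zy iz] /andP[zw nzw]]; split=> //.
    by rewrite properEneq nzw.
  move=> [ez kz zw]; rewrite /sle proper_sub // (proper_neq zw); split=> //.
  apply: (Wdown z w) => //; last exact: proper_sub.
  by apply/betweenP; split=> //; exact: proper_trans wy.
have aboveE w : w \in W -> [set z in R :\: W | sle w z] = touching w y.
  move=> wW; have [ew kw wy iw] := WP _ wW; rewrite RW; apply/setP => z; apply/setIdP/setIdP.
    move=> [/setIdP[/betweenP[ez kz zy] tz] wz]; split=> //; apply/betweenP; split=> //.
    rewrite properEneq [w \subset z]wz andbT; apply: contraNneq tz => <-.
    by case/setIdP: wW.
  move=> [/betweenP[ez wz zy] tz]; split; last exact: proper_sub.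
  by apply/setIdP; split=> //; apply/betweenP; split=> //; exact: proper_trans wz.
exists (N0 :|: [set C in chains sle R | [exists w in W,
    [&& w \in C, C \subset w |: ([set z in W | sle z w & z != w] :|: [set z in R :\: W | sle w z]),
        C :&: [set z in W | sle z w & z != w] \in NL w &
        C :&: [set z in R :\: W | sle w z] \in NU w]]]); split.
- rewrite subUset; apply/andP; split; last by apply/subsetP => C /setIdP[].
  apply: subset_trans N0C _; apply: chainsS; rewrite -RW; exact: subsetDl.
- move=> C /setUP[|/setIdP[_ /exists_inP[w wW /and4P[wC _ CL CU]]]] z; first exact: sat0.
  rewrite belowE // aboveE // in CL CU; have [_ satL _] := hL _ wW; have [_ satU _] := hU _ wW.
  move=> /betweenP[ez kz zy] cmp; have [->//|nzw] := eqVneq z w.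
  (* [z] is comparable with [w], hence lies on one side of it, and the saturation of the part on
     that side applies. *)
  case/orP: (cmp _ wC) => h.
    have /setIP[] // : z \in C :&: between k.+1 (atom k) w.
    apply: (satL _ CL); first by apply/betweenP; split=> //; rewrite properEneq nzw.
    by move=> c /setIP[cC _]; exact: cmp.
  have /setIP[] // : z \in C :&: touching w y.
  apply: (satU _ CU); first by apply/betweenP; split=> //; rewrite properEneq eq_sym nzw.
  by move=> c /setIP[cC _]; exact: cmp.
- apply: (@collapsible_split _ _ sle_refl sle_trans sle_anti R W N0 NL NU) => //; rewrite ?RW //.
  (* The maximality of the lower critical chains, which the join requires, follows from their
     saturation. *)
  + move=> w wW C D; rewrite belowE // => CN DC CD.
    have [_ satL _] := hL _ wW.
    apply/eqP; rewrite eqEsubset CD andbT; apply/subsetP => z zD.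
    apply: (satL _ CN); first by apply: (subsetP (between_widen _ _ kq)); exact: in_chains DC zD.
    move=> c cC; case/chainsP: DC => _ h; apply: h => //; exact: (subsetP CD).
  + by move=> w wW; rewrite belowE //; have [] := hL _ wW.
  + by move=> w wW; rewrite -RW aboveE //; have [] := hU _ wW.
Qed.

Lemma between_drop y : ~~ (sq (E k) \subset y) -> between k.+1 idrel y = between k idrel y.
Proof.
move=> ky; apply/eqP; rewrite eqEsubset (between_widen _ _ (leqnSn k)) andbT.
apply/subsetP => z /betweenP[ez dz zy]; apply/betweenP; split=> //.
rewrite /elt (elt_eqv ez) -{1}(elt_generated ez); apply: connect_edge => i ik iz.
exists i; split=> //; rewrite ltn_neqAle -ltnS ik andbT.
by apply: contraNneq ky => <-; exact: subset_trans iz (proper_sub zy).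
Qed.

Lemma elt_drop y : elt k.+1 y -> ~~ (sq (E k) \subset y) -> elt k y.
Proof.
move=> ey ky; rewrite /elt (elt_eqv ey) -{1}(elt_generated ey); apply: connect_edge => i ik iz.
exists i; split=> //; rewrite ltn_neqAle -ltnS ik andbT.
by apply: contraNneq ky => <-.
Qed.

(** Unless [z] is [atom k], it contains an earlier atom: an element containing no atom but the last
    lies below [atom k]. *)
Lemma generated_proper z : elt k.+1 z -> idrel \proper z -> z != atom k -> idrel \proper generated k z.
Proof.
move=> ez dz zk.
suff [i ik iz] : exists2 i, i < k & sq (E i) \subset z.
  have iq := ltn_trans ik kq; apply: proper_sub_trans (idrel_atom iq) _.
  apply: atom_sub; [exact: generated_eqv|exact: sq_generated].
have [/existsP[i iz]|no] := boolP [exists i : 'I_k, sq (E i) \subset z]; first by exists i.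
case/eqP: zk; apply: below_atom => //; first exact: elt_widen ez.
rewrite -(elt_generated ez) -(elt_generated (atom_elt (ltnSn k))); apply: connect_edge => i ik iz.
exists k; rewrite ltnSn subsetUr; move: ik; rewrite ltnS leq_eqVlt => /orP[/eqP ->|ik] //.
by case/existsP: no; exists (Ordinal ik).
Qed.

Lemma atom_notin : ~~ elt k (atom k).
Proof.
apply/negP => /elt_atom/(_ (idrel_atom kq))[i ik iz].
have ki := E_antichain (ltn_trans ik kq) kq (sq_inj (ltn_trans ik kq) iz).
by rewrite ki ltnn in ik.
Qed.

(** In the main case the other elements comparable with [atom k] are those above it, so this vertex
    contributes the critical chains of the interval above. Without it, [generated k] retracts the
    interval onto elements built from earlier atoms: the smaller interval if [y] is built from them
    too, otherwise a cone with apex [generated k y]. *)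
Lemma sphere_like_step y : elt k.+1 y -> idrel \proper y -> sphere_like (between k.+1 idrel y) idrel y.
Proof.
move=> ey dy; have [ky|ky] := boolP (sq (E k) \subset y); last first.
  rewrite between_drop //; apply: IH => //; exact: elt_drop.
have ky' : atom k \subset y by apply: atom_sub => //; exact: elt_eqv ey.
have [ye|nky] := eqVneq y (atom k).
  have none z : z \in between q idrel y -> False.
    move=> /betweenP[ez dz]; rewrite ye => zk; move: (zk).
    by rewrite (below_atom kq ez dz (proper_sub zk)) properxx.
  have e : between k.+1 idrel y = set0.
    apply/setP => z; rewrite in_set0; apply/negP => /(subsetP (between_widen _ _ kq)); exact: none.
  (* The interval below an atom is empty, so the empty chain is critical. *)
  exists [set set0]; split.
  - by rewrite sub1set; apply/chainsP; rewrite sub0set; split=> // x; rewrite in_set0.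
  - by move=> C _ z /none.
  - rewrite e; have -> : chains sle set0 :\ set0 = set0; last exact: collapsible0.
    apply/setP => C; rewrite in_setD1 in_set0; apply/negbTE/negP.
    by case/andP=> C0 /chainsP[]; rewrite subset0 (negbTE C0).
have kpy : atom k \proper y by rewrite properEneq eq_sym nky.
have [NR [NRC satR cR]] := sphere_like_above ey kpy.
set P := between k.+1 idrel y; pose P' := P :\ atom k.
have kP : atom k \in P by apply/betweenP; split=> //; [exact: atom_elt|exact: idrel_atom].
have cmpP z : z \in between q idrel y -> sle z (atom k) || sle (atom k) z -> z != atom k ->
    atom k \proper z.
  move=> /betweenP[ez dz _] h zk; rewrite properEneq eq_sym zk.
  case/orP: h => // h; by rewrite (below_atom kq ez dz h) eqxx in zk.
have LE : [set z in P :\ atom k | sle z (atom k) || sle (atom k) z] = between k.+1 (atom k) y.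
  apply/setP => z; apply/setIdP/betweenP.
    move=> [/setD1P[zk zP] h]; have /betweenP[ez _ zy] := zP; split=> //.
    by apply: cmpP => //; exact: (subsetP (between_widen _ _ kq)).
  move=> [ez kz zy]; split; last by rewrite /sle (proper_sub kz) orbT.
  rewrite in_setD1; apply/andP; split; first by rewrite eq_sym (proper_neq kz).
  by apply/betweenP; split=> //; exact: proper_trans (idrel_atom kq) kz.
have [N [NC satN cN]] : exists N : {set {set {set T * T}}},
    [/\ N \subset chains sle P', saturated N idrel y & collapsible (chains sle P' :\: N)].
  pose P0 := [set z in P' | generated k z == z].
  have P0elt z : z \in P0 -> elt k z by move=> /setIdP[_ /eqP <-]; exact: generated_elt.
  have retract (N : {set {set {set T * T}}}) : N \subset chains sle P0 -> collapsible (chains sle P0 :\: N) ->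
      collapsible (chains sle P' :\: N).
    move=> NP; apply: (@collapsible_retract _ _ sle_refl sle_trans sle_anti _ _ (generated k)) => //.
    - by apply/subsetP => z /setIdP[].
    - move=> z /setD1P[zk /betweenP[ez dz zy]]; have es := generated_elt k z.
      have sz := generated_sub k (elt_eqv ez).
      apply/setIdP; split; last by rewrite (elt_generated es).
      rewrite in_setD1; apply/andP; split.
        by apply: contraTneq es => ->; exact: atom_notin.
      apply/betweenP; split; [exact: elt_widen es|exact: generated_proper|].
      exact: sub_proper_trans zy.
    - by move=> z /setD1P[_ /betweenP[ez _ _]]; exact: generated_sub (elt_eqv ez).
    - by move=> z /setIdP[_ /eqP].
    - by move=> z z' _ _; exact: generatedS.
  have [eky|neky] := boolP (elt k y).
    have P0E : P0 = between k idrel y.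
      apply/setP => z; apply/idP/idP => [zP0|zI].
        by have /setIdP[/setD1P[_ /betweenP[_ dz zy]] _] := zP0; apply/betweenP; split=> //; exact: P0elt.
      have /betweenP[ez dz zy] := zI.
      apply/setIdP; split; last by rewrite (elt_generated ez).
      rewrite in_setD1; apply/andP; split; last exact: (subsetP (between_widen _ _ (leqnSn k))).
      by apply: contraTneq ez => ->; exact: atom_notin.
    have [N [NC satN cN]] := IH eky dy; exists N; split=> //; last by apply: retract; rewrite P0E.
    apply: subset_trans NC _; apply: chainsS; rewrite -P0E; by apply/subsetP => z /setIdP[].
  exists set0; split; [exact: sub0set|by move=> C; rewrite in_set0|].
  apply: retract; first exact: sub0set.
  have sy := generated_sub k (elt_eqv ey).
  rewrite setD0; apply: (@collapsible_chains_cone _ _ sle_refl _ (generated k y)).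
    have es := generated_elt k y; have dsy := generated_proper ey dy nky.
    apply/setIdP; split; last by rewrite (elt_generated es).
    rewrite in_setD1; apply/andP; split.
      by apply: contraTneq es => ->; exact: atom_notin.
    apply/betweenP; split; [exact: elt_widen es|exact: dsy|].
    by rewrite properEneq sy andbT; apply: contraNneq neky => <-; exact: generated_elt.
  move=> z /setIdP[/setD1P[_ /betweenP[_ _ zy]] /eqP <-]; apply/orP; left.
  by apply: generatedS; exact: proper_sub.
exists (N :|: [set atom k |: C | C in NR]); split.
- rewrite subUset; apply/andP; split.
    by apply: subset_trans NC _; apply: chainsS; exact: subD1set.
  apply/subsetP => _ /imsetP[C CN ->]; have CR := subsetP NRC _ CN.
  apply: (chainsU1 sle_refl kP).
    apply: subsetP CR; apply: chainsS; apply/subsetP => z /betweenP[ez kz zy]; apply/betweenP; split=> //.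
    exact: proper_trans (idrel_atom kq) kz.
  by move=> x /(in_chains CR) /betweenP[_ /proper_sub kx _]; rewrite /sle kx orbT.
- move=> C /setUP[CN|/imsetP[D DN ->]] z zI cmp; first exact: (satN C CN z zI cmp).
  have [->|zk] := eqVneq z (atom k); first exact: setU11.
  rewrite setU1r //; apply: satR => //; last by move=> c cD; apply: cmp; exact: setU1r.
  have kz := cmpP _ zI (cmp _ (setU11 _ _)) zk; have /betweenP[ez dz zy] := zI.
  exact/betweenP.
- by apply: (collapsible_point sle_refl) => //; rewrite LE.
Qed.

End Step.

Lemma sphere_like_between k y : k <= q -> elt k y -> idrel \proper y ->
  sphere_like (between k idrel y) idrel y.
Proof.
elim: k y => [|k IHk] y kq ey dy; first by have [] := elt_atom ey dy.
by apply: sphere_like_step => // x; apply: IHk; exact: ltnW.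
Qed.

End Shelling.
End PartitionLattice.

(** * Wedges of spheres *)

Section Bridge.
Variables (V I C : finType) (K : {set {set V}}) (facet : I -> {set V}).
Variables (idx : C -> I) (p : C -> V).
Hypothesis K_down : forall s t : {set V}, s \in K -> t \subset s -> t \in K.
Hypothesis K0 : set0 \in K.
Hypothesis facetK : forall i, facet i \in K.
Hypothesis facet0 : forall i, facet i != set0.
Hypothesis facet_max : forall i t, t \in K -> facet i \subset t -> t = facet i.
Hypothesis facet_inj : injective facet.
Hypothesis p_facet : forall x, p x \in facet (idx x).
Hypothesis p_inj : forall x y, idx x = idx y -> p x = p y -> x = y.
Hypothesis p_surj : forall i v, v \in facet i -> exists2 x, idx x = i & p x = v.

Let M : {set {set V}} := [set facet i | i in I].
(** The vertices of [K], a private copy [inr (Some x)] of each vertex [p x] of each [facet (idx x)],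
    and a base point [inr None]. *)
Let U : finType := (V + option C)%type.
Implicit Types (A : {set U}).

Definition old A : {set V} := [set v | inl v \in A].
Definition copies A : {set C} := [set x | inr (Some x) \in A].
Definition based A : bool := inr None \in A.

(* Simplices mixing old and new vertices: [old A] together with the projection
   of [copies A] lies in one facet, and fills it only away from the base point. *)
Definition bridge : {set {set U}} := [set A : {set U} |
  if copies A == set0 then (old A \in K) && (based A ==> (old A \notin M))
  else [exists i, [&& [forall x in copies A, idx x == i], old A \subset facet i &
        ~~ (based A && (facet i \subset p @: copies A :|: old A))]]].

Definition old_part : {set {set U}} := [set A in bridge | (copies A == set0) && ~~ based A].
(** With no old vertex present, the copies over one facet and the base point span every simplex but
    the full one: these boundaries are the spheres of the bouquet. *)
Definition new_part : {set {set U}} := [set A in bridge | old A == set0].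

Lemma oldS A A' : A \subset A' -> old A \subset old A'.
Proof. by move=> /subsetP s; apply/subsetP => v; rewrite !inE; exact: s. Qed.

Lemma copiesS A A' : A \subset A' -> copies A \subset copies A'.
Proof. by move=> /subsetP s; apply/subsetP => v; rewrite !inE; exact: s. Qed.

Lemma basedS A A' : A \subset A' -> based A -> based A'.
Proof. by move=> /subsetP; apply. Qed.

Lemma in_bridge0 A : copies A = set0 ->
  (A \in bridge) = (old A \in K) && (based A ==> (old A \notin M)).
Proof. by move=> e; rewrite inE e eqxx. Qed.

Lemma in_bridge1 A x : x \in copies A ->
  reflect [/\ forall y, y \in copies A -> idx y = idx x, old A \subset facet (idx x) &
    ~~ (based A && (facet (idx x) \subset p @: copies A :|: old A))] (A \in bridge).
Proof.
move=> xA; rewrite inE ifF; last by apply/negbTE/set0Pn; exists x.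
apply: (iffP existsP) => [[i /and3P[/forall_inP h1 h2 h3]]|[h1 h2 h3]].
  by have /eqP e := h1 _ xA; subst i; split=> // y /h1 /eqP.
by exists (idx x); apply/and3P; split=> //; apply/forall_inP => y /h1 ->.
Qed.

(** The delicate case loses the last copy while keeping the base point: if the remaining old part
    were a facet, then by maximality it would be the facet under the copies, already filled in the
    larger simplex. *)
Lemma bridge_down A A' : A \in bridge -> A' \subset A -> A' \in bridge.
Proof.
move=> AB s; have [c'0|/set0Pn[x xA']] := eqVneq (copies A') set0; last first.
  have xA := subsetP (copiesS s) _ xA'; have /(in_bridge1 xA)[h1 h2 h3] := AB.
  apply/(in_bridge1 xA'); split=> [y /(subsetP (copiesS s))|| ]; first exact: h1.
    exact: subset_trans (oldS s) h2.
  apply: contra h3 => /andP[/(basedS s) -> /subset_trans]; apply.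
  by apply: setUSS; [apply: imsetS; exact: copiesS|exact: oldS].
rewrite in_bridge0 //; have [c0|/set0Pn[x xA]] := eqVneq (copies A) set0.
  move: AB; rewrite in_bridge0 // => /andP[AK h]; rewrite (K_down AK (oldS s)) /=.
  apply/implyP => /(basedS s) b; apply: contra (implyP h b) => /imsetP[i _ e].
  have := oldS s; rewrite e => /(facet_max AK) ->; exact: imset_f.
have /(in_bridge1 xA)[h1 h2 h3] := AB.
have le := subset_trans (oldS s) h2.
rewrite (K_down (facetK _) le) /=; apply/implyP => /(basedS s) b.
apply: contra h3 => /imsetP[i _ e]; rewrite b /=.
have -> : facet (idx x) = facet i by apply: facet_max => //; rewrite -e.
by rewrite -e; apply: subset_trans (oldS s) (subsetUr _ _).
Qed.

Lemma old_inl v A : old (inl v |: A) = v |: old A.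
Proof. by apply/setP => w; rewrite !inE. Qed.
Lemma old_inlD v A : old (A :\ inl v) = old A :\ v.
Proof. by apply/setP => w; rewrite !inE. Qed.
Lemma old_inr o A : old (inr o |: A) = old A.
Proof. by apply/setP => w; rewrite !inE. Qed.
Lemma old_inrD o A : old (A :\ inr o) = old A.
Proof. by apply/setP => w; rewrite !inE. Qed.
Lemma copies_inl v A : copies (inl v |: A) = copies A.
Proof. by apply/setP => w; rewrite !inE. Qed.
Lemma copies_inlD v A : copies (A :\ inl v) = copies A.
Proof. by apply/setP => w; rewrite !inE. Qed.
Lemma copies_Some x A : copies (inr (Some x) |: A) = x |: copies A.
Proof. by apply/setP => w; rewrite !inE. Qed.
Lemma copies_SomeD x A : copies (A :\ inr (Some x)) = copies A :\ x.
Proof. by apply/setP => w; rewrite !inE. Qed.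
Lemma copies_None A : copies (inr None |: A) = copies A.
Proof. by apply/setP => w; rewrite !inE. Qed.
Lemma copies_NoneD A : copies (A :\ inr None) = copies A.
Proof. by apply/setP => w; rewrite !inE. Qed.
Lemma based_inl v A : based (inl v |: A) = based A.
Proof. by rewrite /based !inE. Qed.
Lemma based_inlD v A : based (A :\ inl v) = based A.
Proof. by rewrite /based !inE. Qed.
Lemma based_Some x A : based (inr (Some x) |: A) = based A.
Proof. by rewrite /based !inE. Qed.
Lemma based_SomeD x A : based (A :\ inr (Some x)) = based A.
Proof. by rewrite /based !inE. Qed.
Lemma based_NoneD A : based (A :\ inr None) = false.
Proof. by rewrite /based !inE. Qed.

Definition toggleE := (old_inl, old_inlD, old_inr, old_inrD, copies_inl, copies_inlD,
  copies_Some, copies_SomeD, copies_None, copies_NoneD, based_inl, based_inlD,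
  based_Some, based_SomeD, based_NoneD).

Lemma ltn_sub_card (T : finType) (X Y : {set T}) :
  X \subset Y -> X != Y -> #|T| - #|Y| < #|T| - #|X|.
Proof.
move=> XY nXY; have lt : #|X| < #|Y| by apply: proper_card; rewrite properEneq nXY.
by apply: ltn_sub2l => //; apply: leq_trans lt _; exact: max_card.
Qed.

(** Grouped by the set of copies. With none, the simplices left contain the base point and form a
    copy of [K :\: M]. With a copy [x] present, toggling the old vertex [p x] does not change which
    part of the facet is covered. *)
Lemma collapsible_to_old : collapsible (K :\: M) -> collapsible (bridge :\: old_part).
Proof.
move=> cK; apply: (@collapsible_fibres _ _ copies (fun X => #|C| - #|X|)).
  move=> A A' _ _ /copiesS s; have [->|ne] := eqVneq (copies A) (copies A'); first by left.
  by right; exact: ltn_sub_card.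
move=> X; have [->|/set0Pn[x xX]] := eqVneq X set0.
  pose h (s : {set V}) : {set U} := inr None |: [set inl v | v in s].
  have old_h s : old (h s) = s.
    by apply/setP => v; rewrite !inE /=; apply/imsetP/idP => [[w ws [->]]|vs] //; exists v.
  have copies_h s : copies (h s) = set0.
    by apply/setP => v; rewrite !inE /=; apply/imsetP => -[].
  have based_h s : based (h s) by rewrite /based setU11.
  have -> : [set A in bridge :\: old_part | copies A == set0] = h @: (K :\: M).
    apply/setP => A; apply/setIdP/imsetP.
      move=> [/setDP[AB AO] /eqP c0].
      have bA : based A by apply: contraNT AO => nb; apply/setIdP; rewrite c0 eqxx nb.
      exists (old A).
        by move: AB; rewrite in_bridge0 // bA /= => /andP[? ?]; apply/setDP.
      apply/setP => -[v|[x|]]; rewrite !inE /=.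
      - by apply/idP/imsetP => [vA|[w + [->]]]; [exists v; rewrite ?inE|rewrite inE].
      - transitivity (x \in copies A); first by rewrite inE.
        by rewrite c0 inE; apply/esym/negbTE/imsetP => -[].
      - by rewrite -[LHS]/(based A) bA.
    move=> [s /setDP[sK sM] ->]; rewrite copies_h eqxx; split=> //.
    apply/setDP; split; first by rewrite in_bridge0 // old_h sK sM implybT.
    by apply/negP => /setIdP[_ /andP[_]]; rewrite based_h.
  apply: (@collapsible_map _ _ h inl) => //.
    by move=> s t _ _ /oldS; rewrite !old_h.
  move=> s v _ _ vs; split; first by rewrite /h imsetU1 setUCA.
  by rewrite !inE /=; apply/imsetP => -[w ws [e]]; rewrite e ws in vs.
apply: (@collapsible_cone _ _ (inl (p x))) => A /setIdP[/setDP[AB AO] /eqP cA];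
  have xA : x \in copies A by rewrite cA.
all: have /(in_bridge1 xA)[h1 h2 h3] := AB.
all: apply/setIdP; rewrite ?toggleE cA eqxx; split=> //; apply/setDP; split;
  last by apply/negP => /setIdP[_ /andP[]]; rewrite toggleE => /eqP c0; rewrite c0 inE in xA.
  have xA' : x \in copies (inl (p x) |: A) by rewrite toggleE.
  apply/(in_bridge1 xA'); rewrite !toggleE; split=> //.
    by rewrite subUset sub1set p_facet.
  have e : p @: copies A :|: [set p x] = p @: copies A.
    by apply/setUidPl; rewrite sub1set imset_f.
  by rewrite setUA e.
have xA' : x \in copies (A :\ inl (p x)) by rewrite toggleE.
apply/(in_bridge1 xA'); rewrite !toggleE; split=> //.
  by apply: subset_trans h2; exact: subsetDl.
apply: contra h3 => /andP[-> /subset_trans]; apply; apply: setUS; exact: subsetDl.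
Qed.

(** The copies reduce to a single one, that of the vertex picked in the old part. Dropping it would
    leave no copy, hence lose the facet to which the simplex belongs. *)
Let marked A : bool :=
  [exists y, (copies A == [set y]) && ([pick v in old A] == Some (p y))].

Let stage A : option (I * bool) :=
  if old A \in M then None else omap (fun x => (idx x, marked A)) [pick x in copies A].

(** Grouped by the old part [b], here nonempty. If [b] is a facet, the base point is excluded and
    any copy over that facet is an apex. Otherwise let [v] be the vertex picked in [b]: over a facet
    containing [b], the copy of [v] may be toggled, as [v] is covered already, unless it is the only
    copy. That lone copy, and the simplices without copies, are matched through the base point. *)
Lemma collapsible_to_new : collapsible (bridge :\: new_part).
Proof.
(* Three weights order the stages over one old part, which explains the factor 3 in the rank: the
   general position of the copies, then the lone copy of the picked vertex, then the remaining stage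
   [None]. *)
pose w (st : option (I * bool)) : nat := if st is Some (_, b) then b : nat else 2.
apply: (@collapsible_fibres _ _ (fun A => (old A, stage A))
  (fun k => 3 * (#|V| - #|k.1|) + w k.2)).
  move=> A A' /setDP[AB _] /setDP[A'B _] s /=.
  have [oE|ne] := eqVneq (old A) (old A'); last first.
    right; have lt := ltn_sub_card (oldS s) ne.
    have w2 st : w st <= 2 by case: st => [[i []]|].
    apply: (@leq_trans (3 * (#|V| - #|old A'|).+1)); last first.
      by apply: leq_trans (leq_addr _ _); rewrite leq_mul2l.
    by rewrite mulnS addnC ltn_add2r ltnS.
  rewrite /stage -oE; case: (old A \in M); first by left.
  case: pickP => [x xA|cA0] /=; last first.
    case: pickP => [y yA'|] /=; last by left.
    by right; rewrite ltn_add2l; case: marked.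
  have xA' := subsetP (copiesS s) _ xA.
  case: pickP => [y yA'|/(_ x)] /=; last by rewrite xA'.
  have /(in_bridge1 xA')[h _ _] := A'B.
  rewrite (h _ yA'); case mA': (marked A'); case mA: (marked A); try by left.
    move/negbT: mA; rewrite /marked; case/negP; move: mA' => /existsP[z /andP[/eqP c' /eqP pk]].
    apply/existsP; exists z; rewrite oE pk eqxx andbT eqEsubset.
    rewrite sub1set -c' (copiesS s) /=; move: xA; rewrite c' in xA'.
    by move: xA'; rewrite inE => /eqP ->.
  by right; rewrite ltn_add2l.
move=> [b st]; have [b0|/set0Pn[v0 v0b]] := eqVneq b set0.
  have -> : [set A in bridge :\: new_part | (old A, stage A) == (b, st)] = set0.
    apply/setP => A; rewrite in_set0; apply/negbTE/negP => /setIdP[/setDP[AB AN] /eqP [ob _]].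
    by case/negP: AN; apply/setIdP; rewrite ob b0.
  exact: collapsible0.
have newN A : old A = b -> A \notin new_part.
  by move=> ob; apply/negP => /setIdP[_]; rewrite ob => /eqP e; rewrite e inE in v0b.
have [/imsetP[i _ bi]|bM] := boolP (b \in M).
  have [v vi] : exists v, v \in facet i by apply/set0Pn; exact: facet0.
  have [x xi _] := p_surj vi.
  have stE A : old A = b -> stage A = None.
    by move=> ob; rewrite /stage ob bi imset_f.
  have char A : old A = b -> (A \in bridge) = ~~ based A && [forall y in copies A, idx y == i].
    move=> ob; have [c0|/set0Pn[y yA]] := eqVneq (copies A) set0.
      rewrite in_bridge0 // ob bi facetK imset_f //= implybF.
      by rewrite (_ : [forall y in copies A, _]) ?andbT //; apply/forall_inP => y; rewrite c0 inE.
    apply/(in_bridge1 yA)/andP => [[h1 h2 h3]|[nb /forall_inP h]].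
      have yi : idx y = i.
        by apply: facet_inj; apply: facet_max => //; rewrite -bi -ob.
      split; last by apply/forall_inP => z /h1 ->; rewrite yi.
      apply: contra h3 => ->; rewrite yi ob -bi; exact: subsetUr.
    have /eqP yi := h _ yA; rewrite yi ob bi (negbTE nb); split=> //.
    by move=> z /h /eqP.
  have [->|nst] := eqVneq st None; last first.
    have -> : [set A in bridge :\: new_part | (old A, stage A) == (b, st)] = set0.
      apply/setP => A; rewrite in_set0; apply/negbTE/negP => /setIdP[_ /eqP [ob e]].
      by rewrite -e stE in nst.
    exact: collapsible0.
  apply: (@collapsible_cone _ _ (inr (Some x))) => A /setIdP[/setDP[AB _] /eqP [ob _]].
    have ob' : old (inr (Some x) |: A) = b by rewrite toggleE.
    apply/setIdP; rewrite stE // ob' eqxx; split=> //; apply/setDP; split; last exact: newN.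
    move: AB; rewrite !char // !toggleE => /andP[-> /forall_inP h]; apply/forall_inP => z.
    by move=> /setU1P[->|/h] //; rewrite xi.
  have ob' : old (A :\ inr (Some x)) = b by rewrite toggleE.
  apply/setIdP; rewrite stE // ob' eqxx; split=> //; apply/setDP; split; last exact: newN.
  move: AB; rewrite !char // !toggleE => /andP[-> /forall_inP h]; apply/forall_inP => z.
  by move=> /setD1P[_ /h].
have stE A : old A = b -> stage A = omap (fun x => (idx x, marked A)) [pick x in copies A].
  by move=> ob; rewrite /stage ob (negbTE bM).
have [->|] := eqVneq st None; [|case: st => // -[i m] _].
  have stN A : old A = b -> (stage A == None) = (copies A == set0).
    move=> ob; rewrite stE //; case: pickP => [x xA|h] /=; apply/esym.
      by apply/negbTE/set0Pn; exists x.
    by apply/eqP/setP => x; rewrite [LHS]h inE.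
  apply: (@collapsible_cone _ _ (inr None)) => A /setIdP[/setDP[AB _]];
    rewrite xpair_eqE => /andP[/eqP ob]; rewrite stN // => /eqP c0;
    move: AB; rewrite in_bridge0 // ob => /andP[bK _]; apply/setIdP.
    have ob' : old (inr None |: A) = b by rewrite toggleE.
    rewrite xpair_eqE stN // !toggleE ob c0 !eqxx; split=> //; apply/setDP; split; last exact: newN.
    by rewrite in_bridge0 ?toggleE // ob bK bM implybT.
  have ob' : old (A :\ inr None) = b by rewrite toggleE.
  rewrite xpair_eqE stN // !toggleE ob c0 !eqxx; split=> //; apply/setDP; split; last exact: newN.
  by rewrite in_bridge0 ?toggleE // ob bK bM implybT.
have stS A : A \in bridge -> old A = b ->
    reflect (exists2 x, x \in copies A & idx x = i /\ marked A = m) (stage A == Some (i, m)).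
  move=> AB ob; rewrite stE //; case: pickP => [x xA|h] /=; last first.
    by constructor => -[x]; rewrite h.
  apply: (iffP eqP) => [[xi mm]|[y yA [yi mm]]]; first by exists x.
  by have /(in_bridge1 yA)[h _ _] := AB; rewrite (h _ xA) yi mm.
have [v vb vp] : exists2 v, v \in b & [pick v in b] = Some v.
  by case: pickP => [v vb|/(_ v0)]; [exists v|rewrite v0b].
have markedE A : old A = b -> marked A = [exists y, (copies A == [set y]) && (p y == v)].
  move=> ob; rewrite /marked ob vp; apply: eq_existsb => y; congr (_ && _).
  by rewrite eq_sym.
have [vi|vi] := boolP (b \subset facet i); last first.
  have -> : [set A in bridge :\: new_part | (old A, stage A) == (b, Some (i, m))] = set0.
    apply/setP => A; rewrite in_set0; apply/negbTE/negP => /setIdP[/setDP[AB _]].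
    rewrite xpair_eqE => /andP[/eqP ob /(stS _ AB ob)[x xA [xi _]]].
    by case/negP: vi; rewrite -ob -xi; have /(in_bridge1 xA)[_ ? _] := AB.
  exact: collapsible0.
have [x xi xv] := p_surj (subsetP vi _ vb).
have markedP A : A \in bridge -> old A = b -> x \in copies A \/ (exists2 y, y \in copies A & idx y = i) ->
    marked A = (copies A == [set x]).
  move=> AB ob h; have h' y : y \in copies A -> idx y = i.
    move=> yA; case: h => [xA|[z zA zi]].
      by have /(in_bridge1 xA)[h _ _] := AB; rewrite (h _ yA).
    by have /(in_bridge1 zA)[h _ _] := AB; rewrite (h _ yA).
  rewrite markedE //; apply/existsP/eqP => [[y /andP[/eqP cy /eqP yv]]|cx]; last first.
    by exists x; rewrite cx xv !eqxx.
  rewrite cy; congr [set _]; apply: p_inj; last by rewrite yv.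
  by rewrite xi; apply: h'; rewrite cy set11.
case: m stS => stS.
  have char A : old A = b -> (A \in bridge) && (stage A == Some (i, true)) = (copies A == [set x]).
    move=> ob; apply/andP/eqP => [[AB /(stS _ AB ob)[y yA [yi]]]|cx].
      by rewrite markedP //; [move/eqP|right; exists y].
    have xA : x \in copies A by rewrite cx set11.
    have AB : A \in bridge.
      apply/(in_bridge1 xA); rewrite cx ob xi; split=> //; first by move=> y /set1P ->.
      (* The lone copy of [v] covers nothing beyond [b], and [b] is not a facet; so the base point
         may be added. *)
      rewrite imset_set1 xv negb_and; apply/orP; right; apply: contra bM => fb.
      rewrite (_ : b = facet i) ?imset_f //; apply/eqP; rewrite eqEsubset vi.
      by apply: subset_trans fb _; rewrite subUset sub1set vb subxx.
    split=> //; apply/(stS _ AB ob); exists x => //; split=> //.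
    by rewrite markedP //; [rewrite cx eqxx|left].
  apply: (@collapsible_cone _ _ (inr None)) => A /setIdP[/setDP[AB _]];
    rewrite xpair_eqE => /andP[/eqP ob AS];
    have: copies A == [set x] by rewrite -char // AB.
    move=> cx; have ob' : old (inr None |: A) = b by rewrite toggleE.
    have /andP[AB' AS'] : (inr None |: A \in bridge) && (stage (inr None |: A) == Some (i, true)).
      by rewrite char // toggleE.
    by apply/setIdP; rewrite xpair_eqE AS' ob' eqxx; split=> //; apply/setDP; split=> //; exact: newN.
  move=> cx; have ob' : old (A :\ inr None) = b by rewrite toggleE.
  have /andP[AB' AS'] : (A :\ inr None \in bridge) && (stage (A :\ inr None) == Some (i, true)).
    by rewrite char // toggleE.
  by apply/setIdP; rewrite xpair_eqE AS' ob' eqxx; split=> //; apply/setDP; split=> //; exact: newN.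
have mem A : old A = b -> A \in bridge -> (exists2 y, y \in copies A & idx y = i) ->
    copies A != [set x] -> A \in [set A in bridge :\: new_part | (old A, stage A) == (b, Some (i, false))].
  move=> ob AB [y yA yi] cx; apply/setIdP; split; first by apply/setDP; split=> //; exact: newN.
  rewrite xpair_eqE ob eqxx /=; apply/(stS _ AB ob); exists y => //; split=> //.
  by rewrite markedP //; [exact: negbTE|right; exists y].
apply: (@collapsible_cone _ _ (inr (Some x))) => A /setIdP[/setDP[AB _]];
  rewrite xpair_eqE => /andP[/eqP ob /(stS _ AB ob)[y yA [yi]]];
  rewrite (markedP _ AB ob (or_intror (ex_intro2 _ _ y yA yi))) => /negbT cx;
  have /(in_bridge1 yA)[h1 h2 h3] := AB;
  have [z zA zx] : exists2 z, z \in copies A & z != x.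
- apply/exists_inP; apply: contraNT cx; rewrite negb_exists_in => /forall_inP h.
  have cs : copies A \subset [set x] by apply/subsetP => z zA; rewrite inE; have := h _ zA; rewrite negbK.
  by rewrite eqEsubset cs sub1set; have := subsetP cs _ yA; rewrite inE => /eqP <-.
- have xA' : x \in copies (inr (Some x) |: A) by rewrite toggleE setU11.
  apply: mem; rewrite ?toggleE //; last first.
  + by apply/eqP => /setP/(_ z); rewrite in_setU1 in_set1 zA orbT (negbTE zx).
  + by exists x => //; exact: setU11.
  apply/(in_bridge1 xA'); rewrite !toggleE xi -yi; split=> //.
    by move=> t /setU1P[->|/h1 //]; rewrite xi yi.
  have e : v |: (p @: copies A :|: old A) = p @: copies A :|: old A.
    by apply/setUidPr; rewrite sub1set in_setU ob vb orbT.
  by rewrite imsetU1 xv -setUA e.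
- apply/exists_inP; apply: contraNT cx; rewrite negb_exists_in => /forall_inP h.
  have cs : copies A \subset [set x] by apply/subsetP => z zA; rewrite inE; have := h _ zA; rewrite negbK.
  by rewrite eqEsubset cs sub1set; have := subsetP cs _ yA; rewrite inE => /eqP <-.
- have zA' : z \in copies (A :\ inr (Some x)) by rewrite toggleE in_setD1 zx.
  apply: mem; rewrite ?toggleE //; last first.
  + by apply/eqP => /setP/(_ x); rewrite in_setD1 in_set1 eqxx.
  + by exists z; [move: zA'; rewrite toggleE|rewrite (h1 _ zA)].
  exact: bridge_down AB (subsetDl _ _).
Qed.

End Bridge.

From mathcomp Require Import all_order all_algebra.
From mathcomp Require Import all_classical all_reals all_analysis.
From mathcomp Require Import lra zify.
Import Order.TTheory GRing.Theory Num.Theory.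
Import numFieldNormedType.Exports.
Local Open Scope classical_set_scope.
Local Open Scope ring_scope.

(** * Homotopy equivalences of realizations *)

Section Homotopy.
Variable R : realType.
Local Notation I := (set_type (unit_interval R)).

Lemma continuous_compT (X Y Z : topologicalType) (f : X -> Y) (g : Y -> Z) :
  continuous f -> continuous g -> continuous (fun x => g (f x)).
Proof. by move=> cf cg x; apply: continuous_comp; [exact: cf|exact: cg]. Qed.

Lemma continuous_pairT (X Y Z : topologicalType) (f : X -> Y) (g : X -> Z) :
  continuous f -> continuous g -> continuous (fun x => (f x, g x)).
Proof. by move=> cf cg x; exact: (cvg_pair (cf x) (cg x)). Qed.

Lemma continuous_fst (X Y : topologicalType) : continuous (fun p : X * Y => p.1).
Proof. by move=> p; exact: cvg_fst. Qed.

Lemma continuous_snd (X Y : topologicalType) : continuous (fun p : X * Y => p.2).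
Proof. by move=> p; exact: cvg_snd. Qed.

Lemma continuous_into_sub (X Y : topologicalType) (A : set Y) (f : X -> set_type A) :
  continuous (fun x => val (f x)) -> continuous f.
Proof. exact: (@continuous_comp_initial (set_type A) X Y val f). Qed.

Lemma continuous_val (Y : topologicalType) (A : set Y) :
  continuous (val : set_type A -> Y).
Proof. exact: (@initial_continuous (set_type A) Y val). Qed.

Lemma continuous_into_RV (X : topologicalType) (V : choiceType) (f : X -> RV R V) :
  (forall v, continuous (fun x => f x v)) -> continuous f.
Proof.
move=> cf x; apply/cvg_sup => v.
exact: (@continuous_comp_initial (RV R V) X R (fun y : RV R V => y v) f (cf v)).
Qed.

Lemma continuous_coord (V : choiceType) (v : V) : continuous (fun x : RV R V => x v : R).
Proof. exact: (@proj_continuous V (fun _ => R : topologicalType) v). Qed.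

Lemma continuous_addT (X : topologicalType) (f g : X -> R) :
  continuous f -> continuous g -> continuous (fun x => f x + g x).
Proof. by move=> cf cg x; exact: (cvgD (cf x) (cg x)). Qed.

Lemma continuous_subT (X : topologicalType) (f g : X -> R) :
  continuous f -> continuous g -> continuous (fun x => f x - g x).
Proof. by move=> cf cg x; exact: (cvgB (cf x) (cg x)). Qed.

Lemma continuous_mulT (X : topologicalType) (f g : X -> R) :
  continuous f -> continuous g -> continuous (fun x => f x * g x).
Proof. by move=> cf cg x; exact: (cvgM (cf x) (cg x)). Qed.

Lemma continuous_cstT (X : topologicalType) (c : R) : continuous (fun _ : X => c).
Proof. by move=> x; exact: cvg_cst. Qed.

Lemma clamp_in (r : R) : Num.min 1 (Num.max 0 r) \in unit_interval R.
Proof.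
by rewrite inE /unit_interval /= in_itv /= le_min ler01 le_max lexx /= ge_min lexx.
Qed.

(** Reparametrised homotopies can thus be written for every real time, without membership proofs
    inside the formulas. *)
Definition clamp (r : R) : I := exist (fun x : R => x \in unit_interval R) _ (clamp_in r).

Lemma unitP (t : I) : 0 <= val t <= 1.
Proof. by case: t => t /=; rewrite inE /unit_interval /= in_itv. Qed.

Lemma clamp_val (r : R) : 0 <= r <= 1 -> val (clamp r) = r.
Proof. by move=> /andP[r0 r1] /=; rewrite max_r // min_r. Qed.

Lemma clamp_continuous : continuous clamp.
Proof.
apply: continuous_into_sub => r.
apply: (@continuous_min R R (fun=> 1) (fun r => Num.max 0 r)); first exact: cvg_cst.
apply: (@continuous_max R R (fun=> 0) id); [exact: cvg_cst|exact: cvg_id].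
Qed.

Lemma homotopic_refl (X Y : topologicalType) (f : X -> Y) :
  continuous f -> homotopic R X Y f f.
Proof.
move=> cf; exists (fun p => f p.2); split=> //.
exact: continuous_compT (@continuous_snd _ _) cf.
Qed.

Lemma homotopic_comp (X Y Z W : topologicalType) (h : X -> Y) (f g : Y -> Z) (k : Z -> W) :
  continuous h -> continuous k ->
  homotopic R Y Z f g -> homotopic R X W (k \o f \o h) (k \o g \o h).
Proof.
move=> ch ck [H [cH [H0 H1]]]; exists (fun p => k (H (p.1, h p.2))); split.
  apply: continuous_compT ck; apply: continuous_compT cH; apply: continuous_pairT.
    exact: continuous_fst.
  exact: continuous_compT (@continuous_snd _ _) ch.
by split=> t x tE /=; rewrite ?(H0 _ _ tE) ?(H1 _ _ tE).
Qed.

Lemma homotopic_trans (X Y : topologicalType) (f g h : X -> Y) :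
  homotopic R X Y f g -> homotopic R X Y g h -> homotopic R X Y f h.
Proof.
move=> [H [cH [H0 H1]]] [K [cK [K0 K1]]].
(* Thanks to [clamp] both halves are continuous on the whole cylinder; they are pasted along two
   closed sets and must agree only at time 1/2. *)
pose L (p : I * X) := H (clamp (2 * val p.1), p.2).
pose M (p : I * X) := K (clamp (2 * val p.1 - 1), p.2).
have cval : continuous (fun p : I * X => val p.1 : R).
  exact: continuous_compT (@continuous_fst _ _) (@continuous_val _ _).
have c2 : continuous (fun p : I * X => 2 * val p.1 : R).
  exact: continuous_mulT (@continuous_cstT _ _) cval.
have cL : continuous L.
  apply: continuous_compT cH; apply: continuous_pairT; last exact: continuous_snd.
  exact: continuous_compT c2 clamp_continuous.
have cM : continuous M.
  apply: continuous_compT cK; apply: continuous_pairT; last exact: continuous_snd.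
  apply: continuous_compT clamp_continuous.
  exact: continuous_subT c2 (@continuous_cstT _ _).
pose N p := if val p.1 <= 2^-1 then L p else M p.
pose A := [set p : I * X | val p.1 <= 2^-1].
pose B := [set p : I * X | 2^-1 <= val p.1].
exists N; split; last split.
- apply/continuous_subspace_setT.
  have -> : [set: I * X] = A `|` B.
    by apply/seteqP; split=> // p _; case/orP: (le_total (val p.1) 2^-1); [left|right].
  apply: withinU_continuous.
  + by apply: (preimage_closed _ (@closed_le R 2^-1)) => p _; exact: cval.
  + by apply: (preimage_closed _ (@closed_ge R 2^-1)) => p _; exact: cval.
  + apply: (@subspace_eq_continuous _ _ _ L); last exact: continuous_subspaceT.
    move=> p /set_mem pA; suff : N p = L p by move=> /esym.
    by rewrite /N ifT.
  + apply: (@subspace_eq_continuous _ _ _ M); last exact: continuous_subspaceT.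
    move=> p /set_mem pB; suff : N p = M p by move=> /esym.
    rewrite /N; case: ifP => // pA.
    have pE : val p.1 = 2^-1 by apply: le_anti; rewrite pA.
    rewrite /L /M pE mulfV ?pnatr_eq0 // subrr.
    by rewrite K0 ?H1 // clamp_val // ?lexx ler01.
- move=> t x t0; rewrite /N /= t0 invr_ge0 ler0n /L /= t0 mulr0 H0 // clamp_val //.
  by rewrite lexx ler01.
- move=> t x t1; rewrite /N /= t1; case: ifP => [|_].
    by move=> hle; exfalso; lra.
  rewrite /M /= t1 K1 // clamp_val; lra.
Qed.

Lemma homotopy_equivalent_sym (X Y : topologicalType) :
  homotopy_equivalent R X Y -> homotopy_equivalent R Y X.
Proof. by move=> [f [g [cf [cg [h1 h2]]]]]; exists g, f. Qed.

Lemma homotopy_equivalent_trans (X Y Z : topologicalType) :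
  homotopy_equivalent R X Y -> homotopy_equivalent R Y Z -> homotopy_equivalent R X Z.
Proof.
move=> [f [g [cf [cg [gf fg]]]]] [f' [g' [cf' [cg' [gf' fg']]]]].
exists (f' \o f), (g \o g'); split; [|split; [|split]].
- by move=> x; apply: continuous_comp; [exact: cf|exact: cf'].
- by move=> x; apply: continuous_comp; [exact: cg'|exact: cg].
- by apply: homotopic_trans gf; exact: (homotopic_comp cf cg gf').
- by apply: homotopic_trans fg'; exact: (homotopic_comp cg' cf' fg).
Qed.

End Homotopy.

(** * Collapses as homotopy equivalences *)

Section FiniteRealization.
Variables (R : realType) (V : finType).
Implicit Types (K S : {set {set V}}) (s t : {set V}).

Definition spt (x : V -> R) : {set V} := finset (fun v => x v != 0).

(** A finite version of [realization], with decidable supports and finite sums, in which the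
    collapses take place; [realization_relabel] leads back. *)
Definition geo K : set (RV R V) :=
  [set x : RV R V | (forall v, 0 <= x v) /\ spt x \in K /\ \sum_v x v = 1].

Definition down_closed K := forall s t, s \in K -> t \subset s -> t \in K.

Lemma geoP K (x : set_type (geo K)) :
  [/\ forall v, 0 <= val x v, spt (val x) \in K & \sum_v val x v = 1].
Proof. by case: x => x /= /set_mem [? []]. Qed.

(** The straight-line homotopy: along each segment the support stays inside the union of the two
    supports, which is a face. *)
Lemma geo_homotopic (X : topologicalType) K (f g : X -> set_type (geo K)) :
  down_closed K -> continuous f -> continuous g ->
  (forall x, spt (val (f x)) :|: spt (val (g x)) \in K) ->
  homotopic R X (set_type (geo K)) f g.
Proof.
move=> dK cf cg fg.
pose h (p : set_type (unit_interval R) * X) : RV R V :=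
  fun v => (1 - val p.1) * val (f p.2) v + val p.1 * val (g p.2) v.
have hP p : h p \in geo K.
  have /andP[t0 t1] := unitP p.1.
  have [f0 _ f1] := geoP (f p.2); have [g0 _ g1] := geoP (g p.2).
  apply/mem_set; split; [|split].
  - by move=> v; rewrite /h addr_ge0 // mulr_ge0 // subr_ge0.
  - apply: (dK _ _ (fg p.2)); apply/fintype.subsetP => v; rewrite !inE -negb_and.
    by apply: contra => /andP[/eqP fv /eqP gv]; rewrite /h fv gv !mulr0 addr0.
  - by rewrite /h big_split /= -!mulr_sumr f1 g1; lra.
exists (fun p => exist (fun x => x \in geo K) (h p) (hP p)); split; last first.
  by split=> t x tE; apply: val_inj; apply/funext => v /=; rewrite /h /= tE; lra.
apply: continuous_into_sub; apply: continuous_into_RV => v /=.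
have ct : continuous (fun p : set_type (unit_interval R) * X => val p.1 : R).
  exact: continuous_compT (@continuous_fst _ _) (@continuous_val _ _).
have coord (k : X -> set_type (geo K)) : continuous k ->
    continuous (fun p : set_type (unit_interval R) * X => val (k p.2) v : R).
  move=> ck; apply: (@continuous_compT _ _ _ (fun p : set_type (unit_interval R) * X => val (k p.2))
    (fun x : RV R V => x v)); last exact: continuous_coord.
  apply: (@continuous_compT _ _ _ (fun p : set_type (unit_interval R) * X => k p.2)).
    exact: continuous_compT (@continuous_snd _ _) ck.
  exact: continuous_val.
rewrite /h; apply: continuous_addT; apply: continuous_mulT; [|exact: coord|exact: ct|exact: coord].
exact: continuous_subT (@continuous_cstT _ _ _) ct.
Qed.

Lemma continuous_bigmin (s : {set V}) :
  continuous (fun x : RV R V => \big[Num.min/1]_(u in s) x u : R).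
Proof.
elim: (index_enum V) => [|u l IH].
  rewrite (_ : (fun _ => _) = fun=> 1); first exact: continuous_cstT.
  by apply/funext => x; rewrite big_nil.
rewrite (_ : (fun _ => _) = fun x : RV R V => if u \in s
    then Num.min (x u) (\big[Num.min/1]_(i <- l | i \in s) x i)
    else \big[Num.min/1]_(i <- l | i \in s) x i); last first.
  by apply/funext => x; rewrite big_cons.
case: (u \in s) => // x.
apply: (@continuous_min R (RV R V) (fun x => x u)); last exact: IH.
exact: continuous_coord.
Qed.

(* The retraction moves the amount [m = min_(u in s) x u] from each vertex of [s]
   to [v]; it is the identity wherever [s] is not contained in the support. *)
Lemma elementary_collapse K s v :
  down_closed K -> s != finset.set0 -> v \notin s -> s \in K -> v |: s \in K ->
  (forall t, t \in K -> s \subset t -> t = s \/ t = v |: s) ->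
  homotopy_equivalent R (set_type (geo K)) (set_type (geo (K :\: [set s; v |: s])%SET)).
Proof.
move=> dK s0 vs sK vsK up; set K' := (K :\: _)%SET.
have K'K t : t \in K' -> t \in K by rewrite inE => /andP[].
have inK' t : t \in K -> ~~ (s \subset t) -> t \in K'.
  move=> tK st; rewrite !inE tK andbT negb_or; apply/andP.
  by split; apply: contraNneq st => ->; rewrite ?subxx // finset.subsetUr.
have K'N t : t \in K' -> ~~ (s \subset t).
  rewrite !inE negb_or => /andP[/andP[ts tvs] tK]; apply/negP => /(up _ tK).
  by case=> e; [move: ts|move: tvs]; rewrite e eqxx.
(* The default 1 of the minimum is harmless: on the realization all coordinates are at most 1, and
   [s] is not empty. *)
pose m (x : RV R V) : R := \big[Num.min/1]_(u in s) x u.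
pose r (x : RV R V) : RV R V := fun w =>
  if w \in s then x w - m x else if w == v then x w + #|s|%:R * m x else x w.
have m_le x w : w \in s -> m x <= x w by move=> ws; exact: bigmin_le_cond.
have m_ge0 x : (forall v, 0 <= x v) -> 0 <= m x.
  by move=> x0; apply: le_bigmin.
have m_ex x : (forall v, 0 <= x v) -> \sum_v x v = 1 -> exists2 u, u \in s & x u = m x.
  move=> x0 x1; have /set0Pn[u0 u0s] := s0.
  have le1 i : i \in s -> x i <= 1.
    by move=> _; rewrite -x1 (bigD1 i) //= lerDl sumr_ge0.
  rewrite /m (bigmin_eq_arg 1 u0 _ _ u0s) //; case: arg_minP => // u us _; by exists u.
have r_out x w : m x = 0 -> r x w = x w.
  by move=> m0; rewrite /r m0 mulr0 subr0 addr0; case: ifP => // _; case: ifP.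
have r_sum x : \sum_w r x w = \sum_w x w.
  have -> : \sum_w r x w = \sum_w (x w + ((if w \in s then - m x else 0)
       + (if w == v then #|s|%:R * m x else 0))).
    apply: eq_bigr => w _; rewrite /r; case: ifP => [ws|_].
      by rewrite (negbTE (contraNneq _ vs)) ?addr0 // => e; rewrite -e.
    by case: ifP; rewrite add0r ?addr0.
  rewrite big_split big_split /= -!big_mkcond /= big_pred1_eq sumr_const.
  by rewrite mulNrn mulr_natl addNr addr0.
have r_ge0 x : (forall v, 0 <= x v) -> forall w, 0 <= r x w.
  move=> x0 w; rewrite /r; case: ifP => [ws|_]; first by rewrite subr_ge0 m_le.
  by case: ifP => // _; rewrite addr_ge0 // mulr_ge0 ?ler0n // m_ge0.
have r_spt x : (forall v, 0 <= x v) -> \sum_v x v = 1 -> spt x \in K ->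
    spt (r x) \in K' /\ spt x :|: spt (r x) \in K.
  move=> x0 x1 xK; have [u us ux] := m_ex x x0 x1.
  have ru : u \notin spt (r x) by rewrite inE /r us ux subrr eqxx.
  (* If the minimum is positive, [s] lies in the support, which is then [s] or [v |: s]; the vertex
     [u] attaining the minimum drops out of it. *)
  have [m0|m0] := eqVneq (m x) 0.
    have -> : spt (r x) = spt x by apply/setP => w; rewrite !inE r_out.
    rewrite finset.setUid; split=> //; apply: inK' => //.
    by apply/subsetPn; exists u => //; rewrite inE ux m0 eqxx.
  have ssx : s \subset spt x.
    apply/fintype.subsetP => w ws; rewrite inE gt_eqF //; apply: lt_le_trans (m_le x w ws).
    by rewrite lt_def m0 m_ge0.
  have xvs : spt x \subset v |: s.
    by have [->|->] := up _ xK ssx; rewrite ?subxx // finset.subsetUr.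
  have rvs : spt (r x) \subset v |: s.
    apply/fintype.subsetP => w; rewrite in_setU1; apply: contraTT.
    rewrite negb_or => /andP[wv ws]; rewrite inE negbK /r (negbTE ws) (negbTE wv).
    apply/eqP; have := fintype.subsetP xvs w; rewrite in_setU1 (negbTE wv) (negbTE ws) inE.
    by case: eqP => // _ /(_ isT).
  split; last by apply: (dK _ _ vsK); rewrite finset.subUset xvs.
  by apply: inK'; [exact: (dK _ _ vsK rvs)|apply/subsetPn; exists u].
have rP (x : set_type (geo K)) : r (val x) \in geo K'.
  have [x0 xK x1] := geoP x; apply/mem_set; split; first exact: r_ge0.
  by split; [have [] := r_spt _ x0 x1 xK|rewrite r_sum].
have iP (x : set_type (geo K')) : val x \in geo K.
  by have [x0 xK x1] := geoP x; apply/mem_set; split; [|split; [exact: K'K|]].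
pose rr (x : set_type (geo K)) : set_type (geo K') := exist (fun x => x \in geo K') _ (rP x).
pose ii (x : set_type (geo K')) : set_type (geo K) := exist (fun x => x \in geo K) _ (iP x).
have cr : continuous rr.
  apply: continuous_into_sub.
  suff cr : continuous r by exact: (@continuous_compT _ _ _ _ r (@continuous_val _ (geo K)) cr).
  apply: continuous_into_RV => w.
  suff : continuous (fun x : RV R V => if w \in s then x w - m x
    else if w == v then x w + #|s|%:R * m x else x w : R) by [].
  case: (w \in s); last case: (w == v); last exact: continuous_coord.
    exact: continuous_subT (@continuous_coord _ _ _) (@continuous_bigmin s).
  apply: continuous_addT; first exact: continuous_coord.
  exact: continuous_mulT (@continuous_cstT _ _ _) (@continuous_bigmin s).
have ci : continuous ii by apply: continuous_into_sub; exact: continuous_val.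
exists rr, ii; split=> //; split=> //; split.
  apply: geo_homotopic => //; first exact: continuous_compT cr ci.
    by move=> x; exact: cvg_id.
  move=> x; have [x0 xK x1] := geoP x.
  by have [_] := r_spt _ x0 x1 xK; rewrite finset.setUC.
suff -> : rr \o ii = id by apply: homotopic_refl => x; exact: cvg_id.
apply/funext => x; apply: val_inj; apply/funext => w /=; apply: r_out.
have [x0 xK x1] := geoP x.
have /subsetPn[u us] := K'N _ xK; rewrite inE negbK => /eqP u0.
by apply: le_anti; rewrite m_ge0 // andbT -u0 m_le.
Qed.

(** A pair free in [S] is free in [K]: a simplex outside [S] containing [s] would put [s] into the
    complex [K :\: S]. Keeping the empty simplex out of [S] makes every step geometric, since
    removing it together with a last vertex would empty the space. *)
Lemma collapse_homotopy_equivalent K S :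
  collapsible S -> down_closed K -> down_closed (K :\: S)%SET ->
  S \subset K -> finset.set0 \notin S ->
  homotopy_equivalent R (set_type (geo K)) (set_type (geo (K :\: S)%SET)).
Proof.
move=> cS; elim: cS K => [K _ _ _ _|{}S s v vs sS vsS up _ IH K dK dKS SK S0].
  rewrite finset.setD0; exists id, id; split; first by move=> x; exact: cvg_id.
  by split; [move=> x; exact: cvg_id|split; apply: homotopic_refl => x; exact: cvg_id].
have upK t : t \in K -> s \subset t -> t = s \/ t = v |: s.
  move=> tK st; have [tS|tS] := boolP (t \in S); first exact: up.
  have: s \in (K :\: S)%SET by apply: (dKS t) => //; rewrite inE tS.
  by rewrite inE sS.
pose K' := (K :\: [set s; v |: s])%SET.
have inK' t : (t \in K') = [&& t != s, t != v |: s & t \in K].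
  by rewrite !inE negb_or -andbA.
have e : (K :\: S)%SET = (K' :\: (S :\: [set s; v |: s]))%SET.
  apply/setP => t; rewrite finset.in_setD [RHS]finset.in_setD [t \in K']finset.in_setD finset.in_setD.
  case tp: (t \in [set s; v |: s]%SET) => //=.
  by move: tp; rewrite !inE => /orP[] /eqP ->; rewrite ?sS ?vsS.
have dK' : down_closed K'.
  move=> t t'; rewrite !inK' => /and3P[ts tvs tK] tt'; rewrite (dK _ _ tK tt') andbT.
  apply/andP; split; apply: contraNneq ts => E; apply/eqP.
    have [//|E'] : t = s \/ t = v |: s by apply: upK => //; rewrite -E.
    by rewrite E' eqxx in tvs.
  have [//|E'] : t = s \/ t = v |: s.
    by apply: upK => //; apply: fintype.subset_trans tt'; rewrite E finset.subsetUr.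
  by rewrite E' eqxx in tvs.
have h1 : homotopy_equivalent R (set_type (geo K)) (set_type (geo K')).
  apply: elementary_collapse => //; try exact: (fintype.subsetP SK).
  by apply: contraNneq S0 => <-.
apply: homotopy_equivalent_trans h1 _; rewrite e; apply: IH => //.
- by rewrite -e.
- apply/fintype.subsetP => t; rewrite finset.in_setD => /andP[tp tS].
  by rewrite finset.in_setD tp (fintype.subsetP SK).
- by rewrite finset.in_setD (negbTE S0) andbF.
Qed.

End FiniteRealization.

Arguments geo R {V} K.

(** Injectivity is asked only on a set [A] containing all vertices in use, because maps such as
    [subspace_of] are injective only on equivalence relations. Coordinates outside the image of [A]
    vanish, so pushing forward and pulling back are inverse to each other. *)
Lemma realization_relabel (R : realType) (V1 : finType) (V2 : choiceType)
    (K : {set {set V1}}) (A : {set V1}) (f : V1 -> V2) (L : set (set V2)) :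
  (forall s, s \in K -> s \subset A) -> {in A &, injective f} ->
  (forall S, L S <-> exists2 s : {set V1}, s \in K & S = f @` [set u | u \in s]) ->
  homotopy_equivalent R (set_type (geo R K)) (set_type (realization R L)).
Proof.
move=> KA injf LE.
have sumE (s : {set V1}) (y : V2 -> R) : s \subset A ->
    \sum_(v \in f @` [set u | u \in s]) y v = \sum_(u in s) y (f u).
  move=> sA; rewrite fsbig_image; last first.
    by move=> u u'; rewrite !inE /= => us u's; apply: injf; exact: (fintype.subsetP sA).
  rewrite (fsbigE (enum s)) ?enum_uniq //=; first last.
  - by move=> u us; rewrite mem_enum us.
  - by move=> u; rewrite /= mem_enum.
  rewrite big_enum_cond /=; apply: eq_bigl => u.
  by case: (boolP (u \in s)) => //= us; rewrite mem_set.
pose F (x : V1 -> R) (v : V2) : R := if [pick u in A | f u == v] is Some u then x u else 0.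
pose G (y : V2 -> R) (u : V1) : R := if u \in A then y (f u) else 0.
have Ff x u : u \in A -> F x (f u) = x u.
  move=> uA; rewrite /F; case: pickP => [u' /andP[u'A /eqP /injf ->] //|/(_ u)].
  by rewrite uA eqxx.
have sptF x : spt x \subset A -> supp (F x) = f @` [set u | u \in spt x].
  move=> xA; apply/seteqP; split=> [v|_ [u /= xu <-]].
    rewrite /supp /= /F; case: pickP => [u /andP[uA /eqP <-] xu|_]; last by rewrite eqxx.
    by exists u => //=; rewrite inE.
  by rewrite /supp /= Ff ?(fintype.subsetP xA) //; move: xu; rewrite inE.
have sum_spt (x : V1 -> R) : \sum_(u in spt x) x u = \sum_u x u.
  by rewrite big_mkcond; apply: eq_bigr => u _; rewrite inE; case: eqP.
have FP (x : set_type (geo R K)) : F (val x) \in realization R L.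
  have [x0 xK x1] := geoP x; have xA := KA _ xK; apply/mem_set.
  split; [|split; [|split]].
  - by move=> v; rewrite /F; case: pickP.
  - by rewrite sptF //; apply: finite_image.
  - by rewrite sptF //; apply/LE; exists (spt (val x)).
  - rewrite sptF // sumE // -x1 -sum_spt; apply: eq_bigr => u xu.
    by rewrite Ff // (fintype.subsetP xA).
have GP' (y : set_type (realization R L)) : spt (G (val y)) \in K /\
    supp (val y) = f @` [set u | u \in spt (G (val y))].
  have [y0 [_ [/LE[s sK sE] _]]] := set_mem (valP y).
  suff -> : spt (G (val y)) = s by [].
  apply/setP => u; rewrite inE /G; have sA := KA _ sK.
  case: (boolP (u \in A)) => uA; last first.
    by rewrite eqxx; apply/esym/negbTE; apply: contra uA => /(fintype.subsetP sA).
  apply/idP/idP => [h|us].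
    have : supp (val y) (f u) by [].
    rewrite sE => -[u' /= u's e]; rewrite -(injf _ _ _ _ e) //; exact: (fintype.subsetP sA).
  by have : supp (val y) (f u) by rewrite sE; exists u.
have GP (y : set_type (realization R L)) : G (val y) \in geo R K.
  have [sK sE] := GP' y; have [y0 [_ [_ y1]]] := set_mem (valP y).
  apply/mem_set; split; [|split=> //].
    by move=> u; rewrite /G; case: ifP.
  rewrite -y1 sE sumE ?KA // -sum_spt; apply: eq_bigr => u uK.
  by rewrite /G (fintype.subsetP (KA _ sK)).
exists (fun x => exist (fun z => z \in realization R L) _ (FP x)),
       (fun y => exist (fun z => z \in geo R K) _ (GP y)).
have idc (X : topologicalType) : homotopic R X X id id.
  by apply: homotopic_refl => x; exact: cvg_id.
split; [|split; [|split]].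
- apply: continuous_into_sub; apply: continuous_into_RV => v.
  suff cF : continuous (fun x : RV R V1 => F x v).
    exact: (@continuous_compT _ _ _ _ (fun x : RV R V1 => F x v) (@continuous_val _ (geo R K)) cF).
  rewrite /F; case: pickP => [u _|_]; first exact: continuous_coord.
  exact: continuous_cstT.
- apply: continuous_into_sub; apply: continuous_into_RV => u.
  suff cG : continuous (fun y : RV R V2 => G y u).
    exact: (@continuous_compT _ _ _ _ (fun y : RV R V2 => G y u) (@continuous_val _ (realization R L)) cG).
  rewrite /G; case: (u \in A); first exact: continuous_coord.
  exact: continuous_cstT.
- rewrite (_ : _ \o _ = id) //; apply/funext => x; apply: val_inj; apply/funext => u /=.
  have [_ xK _] := geoP x; rewrite /G; case: ifP => [uA|/negbT uA]; first exact: Ff.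
  apply/esym/eqP; have := contra (fintype.subsetP (KA _ xK) u) uA.
  by rewrite inE negbK.
- rewrite (_ : _ \o _ = id) //; apply/funext => y; apply: val_inj; apply/funext => v /=.
  rewrite /F; case: pickP => [u /andP[uA /eqP <-]|no]; first by rewrite /G uA.
  apply/esym/eqP/negP => /negP yv; have [sK sE] := GP' y.
  have : supp (val y) v by [].
  rewrite sE => -[u /= us e]; have := no u.
  by rewrite (fintype.subsetP (KA _ sK)) // e eqxx.
Qed.

(** * From critical facets to a wedge of spheres *)

Section WedgeOfFacets.
Variables (R : realType) (V : finType) (K M : {set {set V}}).
Hypothesis K_down : down_closed K.
Hypothesis K0 : finset.set0 \in K.
Hypothesis MK : M \subset K.
Hypothesis M0 : finset.set0 \notin M.
Hypothesis M_facet : forall s t : {set V}, s \in M -> t \in K -> s \subset t -> t = s.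
Hypothesis K_M : collapsible (K :\: M)%SET.

(** Each sphere has the dimension of its critical facet: it bounds a simplex whose vertices are the
    copies of those of the facet and the base point. *)
Let ds : seq nat := [seq #|pred_of_set s|.-1 | s <- enum M].
Let I : finType := 'I_(size ds).
Let C : finType := {i : 'I_(size ds) & 'I_(nth 0%N ds i).+1}.
Let U : finType := (V + option C)%type.
Let facet (i : I) : {set V} := nth finset.set0 (enum M) i.

Let ltM (i : I) : (i < size (enum M))%N.
Proof. by apply: leq_trans (ltn_ord i) _; rewrite size_map. Qed.

Let facetM i : facet i \in M.
Proof. by rewrite -mem_enum mem_nth. Qed.

Let facet_card (i : I) : (nth 0%N ds i).+1 = #|pred_of_set (facet i)|.
Proof.
have f0 : facet i != finset.set0 by apply: contraNneq M0 => <-; exact: facetM.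
by rewrite (nth_map finset.set0) ?ltM // prednK // card_gt0.
Qed.

Let idx (x : C) : I := tag x.
Let p (x : C) : V := enum_val (cast_ord (facet_card (tag x)) (tagged x)).

Let facet_inj : injective facet.
Proof.
move=> i j /eqP; rewrite nth_uniq ?enum_uniq // => /eqP e; exact: val_inj.
Qed.

Let M_image : [set facet i | i in I]%SET = M.
Proof.
apply/setP => s; apply/imsetP/idP => [[i _ ->] //|sM].
have lt : (index s (enum M) < size ds)%N by rewrite size_map index_mem mem_enum.
by exists (Ordinal lt) => //; rewrite /facet nth_index // mem_enum.
Qed.

Let p_inj x y : idx x = idx y -> p x = p y -> x = y.
Proof.
case: x y => [i j] [i' j']; rewrite /idx /= => e; subst i'.
by rewrite /p /= => /enum_val_inj /cast_ord_inj ->.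
Qed.

Let p_surj i v : v \in facet i -> exists2 x, idx x = i & p x = v.
Proof.
move=> vi; exists (Tagged (fun i : I => 'I_(nth 0%N ds i).+1)
  (cast_ord (esym (facet_card i)) (enum_rank_in vi v))) => //.
by rewrite /p /= cast_ordKV enum_rankK_in.
Qed.

Let br := bridge K facet idx p.

Let br_down : down_closed br.
Proof.
move=> s t; apply: bridge_down => //.
- by move=> i; exact: (fintype.subsetP MK).
- by move=> i t'; exact: M_facet.
Qed.

Let oldP : old_part K facet idx p \subset br.
Proof. by apply/fintype.subsetP => s /setIdP[]. Qed.

Let newP : new_part K facet idx p \subset br.
Proof. by apply/fintype.subsetP => s /setIdP[]. Qed.

Let subD (X Y : {set {set U}}) : X \subset Y -> (Y :\: (Y :\: X))%SET = X.
Proof. by move=> XY; rewrite finset.setDDr finset.setDv finset.set0U; apply/finset.setIidPr. Qed.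

Let set0_old : finset.set0 \in old_part K facet idx p.
Proof.
have e : copies (finset.set0 : {set U}) = finset.set0 by apply/setP => x; rewrite !inE.
have o : old (finset.set0 : {set U}) = finset.set0 by apply/setP => x; rewrite !inE.
have b : based (finset.set0 : {set U}) = false by rewrite /based inE.
by apply/setIdP; rewrite in_bridge0 // e o b K0 eqxx.
Qed.

Let set0_new : finset.set0 \in new_part K facet idx p.
Proof.
apply/setIdP; split; first exact: (fintype.subsetP oldP).
by apply/eqP/setP => x; rewrite !inE.
Qed.

(** Both parts are reached from the bridge by collapsing, in opposite directions. *)
Let old_new : homotopy_equivalent R
  (set_type (geo R (old_part K facet idx p))) (set_type (geo R (new_part K facet idx p))).
Proof.
have collapse (X : {set {set U}}) : X \subset br -> collapsible (br :\: X)%SET -> finset.set0 \in X ->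
    down_closed X -> homotopy_equivalent R (set_type (geo R br)) (set_type (geo R X)).
  move=> Xbr cX X0 dX; have := @collapse_homotopy_equivalent R _ br _ cX br_down.
  rewrite (subD Xbr); apply=> //; first exact: finset.subsetDl.
  by rewrite finset.in_setD X0.
apply: homotopy_equivalent_trans (homotopy_equivalent_sym (collapse _ oldP _ set0_old _)) _.
- apply: collapsible_to_old => //; last by rewrite M_image.
  by move=> x; exact: enum_valP.
- move=> s t /setIdP[sb /andP[/eqP c b]] ts; apply/setIdP; split; first exact: br_down ts.
  apply/andP; split; last by apply: contra b; exact: basedS.
  by rewrite -finset.subset0 -c; exact: copiesS.
apply: collapse => //.
- apply: collapsible_to_new => //.
  + by move=> i; exact: (fintype.subsetP MK).
  + by move=> i; apply: contraNneq M0 => <-.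
  + by move=> i t; exact: M_facet.
- move=> s t /setIdP[sb /eqP o] ts; apply/setIdP; split; first exact: br_down ts.
  by rewrite -finset.subset0 -o; exact: oldS.
Qed.

Let old_realization (V2 : choiceType) (A : {set V}) (f : V -> V2) (v2 : V2) (L : set (set V2)) :
  (forall s, s \in K -> s \subset A) -> {in A &, injective f} ->
  (forall S, L S <-> exists2 s : {set V}, s \in K & S = f @` [set u | u \in s]) ->
  homotopy_equivalent R (set_type (geo R (old_part K facet idx p))) (set_type (realization R L)).
Proof.
move=> KA injf LE.
(* [v2] is a junk value: no new vertex occurs in [old_part]. *)
pose g (u : U) : V2 := if u is inl v then f v else v2.
apply: (@realization_relabel R U V2 _ [set inl v | v in A]%SET g).
- move=> s /setIdP[sb /andP[/eqP c b]]; apply/fintype.subsetP => -[v vs|[x xs|bs]].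
  + apply: imset_f; apply: (fintype.subsetP (KA (old s) _)); last by rewrite inE.
    by move: sb; rewrite in_bridge0 // => /andP[].
  + have : x \in copies s by rewrite inE.
    by rewrite c inE.
  + by rewrite /based bs in b.
- by move=> _ _ /imsetP[v vA ->] /imsetP[w wA ->] /= /(injf _ _ vA wA) ->.
- move=> S; split=> [/LE[s sK ->]|[s /setIdP[sb /andP[/eqP c b]] ->]].
    pose s' : {set U} := [set inl v | v in s]%SET.
    have os : old s' = s.
      by apply/setP => v; rewrite inE; apply/imsetP/idP => [[w ws [->]]|vs] //; exists v.
    have cs : copies s' = finset.set0.
      by apply/setP => v; rewrite !inE; apply/imsetP => -[].
    have bs : based s' = false by apply/imsetP => -[].
    exists s'; first by apply/setIdP; rewrite cs bs eqxx in_bridge0 // os sK bs.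
    apply/seteqP; split=> [_ [v /= vs <-]|_ [u /= /imsetP[v vs ->] <-]]; last by exists v.
    by exists (inl v) => //=; exact: imset_f.
  apply/LE; exists (old s); first by move: sb; rewrite in_bridge0 // => /andP[].
  apply/seteqP; split=> [_ [[v|[x|]] /= us <-]|_ [v /= vs <-]].
  + by exists v => //=; rewrite inE.
  + have : x \in copies s by rewrite inE.
    by rewrite c inE.
  + by rewrite /based us in b.
  + by exists (inl v) => //=; move: vs; rewrite inE.
Qed.

Let new_realization : homotopy_equivalent R
  (set_type (geo R (new_part K facet idx p))) (set_type (realization R (@wedge_faces ds))).
Proof.
(* The new vertices are literally those of the wedge; the value [None] on old vertices is junk. *)
pose g (u : U) : wedge_vertex ds := if u is inr o then o else None.
apply: (@realization_relabel R U (wedge_vertex ds) _ [set inr v | v in [set: option C]]%SET g).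
- move=> s /setIdP[sb /eqP o]; apply/fintype.subsetP => -[v vs|x xs]; last exact: imset_f.
  have : v \in old s by rewrite inE.
  by rewrite o inE.
- by move=> _ _ /imsetP[v _ ->] /imsetP[w _ ->] /= ->.
have based0 (s : {set U}) : old s = finset.set0 -> copies s = finset.set0 -> s \in br.
  by move=> o c; rewrite /br in_bridge0 // o K0 M_image M0 implybT.
move=> S; split=> [WS|[s /setIdP[sb /eqP o] SE]].
  pose s : {set U} := finset (fun u : U => if u is inr x then x \in S else false).
  have o : old s = finset.set0 by apply/setP => v; rewrite !inE.
  have cE x : (x \in copies s) = (Some x \in S) by rewrite !inE.
  exists s; last first.
    apply/seteqP; split=> [x Sx|_ [[v|x] /= + <-]]; rewrite ?inE //.
    by exists (inr x) => //=; rewrite inE mem_set.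
  apply/setIdP; rewrite o eqxx; split=> //.
  have [c|/set0Pn[x xs]] := eqVneq (copies s) finset.set0; first exact: based0.
  have Sx : S (Some x) by apply/set_mem; rewrite -cE.
  case: WS => [/(_ _ Sx) //|[i [Si Sf]]].
  have Sidx y : y \in copies s -> idx y = i.
    by rewrite cE => /set_mem /Si [//|[j [->]]].
  apply/(in_bridge1 _ _ _ _ xs); rewrite o finset.setU0 (Sidx _ xs); split=> //.
  - exact: finset.sub0set.
  - apply/negP => /andP[b /fintype.subsetP h]; apply: Sf; split.
      by move: b; rewrite /based inE /= => /set_mem.
    move=> j; apply/set_mem; rewrite -cE.
    have := h (p (existT _ i j)); rewrite enum_valP => /(_ isT) /imsetP[y ys e].
    by rewrite (@p_inj (existT _ i j) y) // (Sidx _ ys).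
have SP x : S x <-> inr x \in s.
  rewrite SE; split=> [[[v|y] /= us e]|xs]; last by exists (inr x).
    have : v \in old s by rewrite inE.
    by rewrite o inE.
  by rewrite -e.
have [c|/set0Pn[x xs]] := eqVneq (copies s) finset.set0.
  left=> -[x /SP xs|//]; have : x \in copies s by rewrite inE.
  by rewrite c inE.
have /(in_bridge1 _ _ _ _ xs)[h1 _ h3] := sb.
right; exists (idx x); split=> [[y /SP ys|_]|[/SP b h]]; last 2 first.
- by left.
- move/negP: h3; apply; rewrite /based b /= o finset.setU0; apply/fintype.subsetP => v vi.
  have [y yi <-] := p_surj vi; apply: imset_f; rewrite inE; apply/SP.
  by case: y yi => i j /= e; move: h; rewrite -e; apply.
right; have yi := h1 y; rewrite inE ys in yi; have := yi isT.
by case: (y) => i j /= <-; exists j.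
Qed.

Lemma realization_wedge (V2 : choiceType) (A : {set V}) (f : V -> V2) (v2 : V2) (L : set (set V2)) :
  (forall s, s \in K -> s \subset A) -> {in A &, injective f} ->
  (forall S, L S <-> exists2 s : {set V}, s \in K & S = f @` [set u | u \in s]) ->
  homotopy_wedge_of_spheres R (set_type (realization R L)).
Proof.
move=> KA injf LE; right; exists ds.
apply: homotopy_equivalent_trans new_realization.
apply: homotopy_equivalent_trans old_new.
apply: homotopy_equivalent_sym; exact: (old_realization v2 KA injf LE).
Qed.

End WedgeOfFacets.

(** * Diagonal arrangements *)

Section Subspaces.
Variables (R : realType) (n : nat).
Local Notation V := {set 'I_n * 'I_n}.

Definition subspace_of (x : V) : set ('I_n -> R) :=
  [set u | forall a b, (a, b) \in x -> u a = u b].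

Lemma subspace_ofS (x z : V) : x \subset z -> subspace_of z `<=` subspace_of x.
Proof. by move=> /fintype.subsetP xz u uz a b /xz; exact: uz. Qed.

(** Tested on the indicator function of the [x]-class of [a], which lies in [subspace_of x]. *)
Lemma subspace_of_sub (x z : V) : eqv x -> subspace_of x `<=` subspace_of z -> z \subset x.
Proof.
move=> /eqvP[r s t] h; apply/fintype.subsetP => -[a b] abz.
pose u (c : 'I_n) : R := if (a, c) \in x then 1 else 0.
have /h ux : subspace_of x u.
  move=> c d cd; rewrite /u; case: ifPn => [ac|nac]; first by rewrite (t _ _ _ ac cd).
  by case: ifPn => // ad; rewrite (t _ _ _ ad (s _ _ cd)) in nac.
have := ux _ _ abz; rewrite /u r; case: ifP => // _ /eqP; by rewrite oner_eq0.
Qed.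

Lemma subspace_of_inj (x z : V) : eqv x -> eqv z -> subspace_of x = subspace_of z -> x = z.
Proof.
move=> ex ez e; apply/eqP; rewrite finset.eqEsubset !subspace_of_sub //; by rewrite e.
Qed.

(** The hypothesis says that [x] is covered by the squares of atoms inside it. It need not be
    transitive: the equality imposed by a path follows from those along its edges. *)
Lemma subspace_of_generated (E : nat -> {set 'I_n}) q (x : V) :
  (forall a b, (a, b) \in x -> exists2 i, (i < q)%N & [/\ sq (E i) \subset x, a \in E i & b \in E i]) ->
  subspace_of (generated E q x) = subspace_of x.
Proof.
move=> h; apply/seteqP; split=> u uh a b.
  move=> /h[i iq [ix aE bE]]; apply: uh; rewrite in_generated; apply: connect1.
  by apply/edgeP; exists i.
rewrite in_generated => /connectP[p]; elim: p a => [|c p IH] a /=; first by move=> _ ->.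
by move=> /andP[/edge_sub /uh -> /IH h'] /h'.
Qed.

Lemma subspace_of_idrel : subspace_of (idrel _) = [set: 'I_n -> R].
Proof. by apply/seteqP; split=> // u _ a b; rewrite in_idrel => /eqP ->. Qed.

End Subspaces.

Arguments subspace_of R {n} x.

(** * The intersection lattice of a shellable complex *)

Section DiagonalArrangement.
Variables (R : realType) (n : nat) (D : {set {set 'I_n}}) (s : seq {set 'I_n}).
Hypothesis D_complex : is_simplicial_complex D.
Hypothesis D_dim : dim_le D (n%:Z - 3).
Hypothesis s_uniq : uniq s.
Hypothesis s_facets : forall F : {set 'I_n}, F \in s <-> is_facet D F.
Hypothesis s_shelling : forall k, (0 < k < size s)%N ->
  pure_of_dim (shell_part s k) (#|nth finset.set0 s k|%:Z - 2)%R.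

Let q := size s.
Let E k : {set 'I_n} := ~: nth finset.set0 s k.

Let facet_nth k : (k < q)%N -> is_facet D (nth finset.set0 s k).
Proof. by move=> kq; apply/s_facets; exact: mem_nth. Qed.

(** The bound [n - 3] on the dimension allows a facet at most [n - 2] vertices, which leaves two
    points in the complement. *)
Let E_gt1 i : (i < q)%N -> (1 < #|E i|)%N.
Proof.
move=> /facet_nth[FD _]; have := D_dim FD; have := cardsCs (nth finset.set0 s i).
by rewrite card_ord -/(E i) => ->; have := max_card (mem (E i)); rewrite card_ord; lia.
Qed.

Let E_antichain i j : (i < q)%N -> (j < q)%N -> E i \subset E j -> i = j.
Proof.
move=> iq jq; rewrite finset.setCS => ji; have [_ max] := facet_nth jq.
have [iD _] := facet_nth iq; have /eqP := max _ iD ji.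
by rewrite nth_uniq // => /eqP.
Qed.

(** [H] is a maximal face of the shelling part containing the intersection of facets [i] and [k]. By
    purity it misses exactly one vertex [v] of facet [k]. A facet [j] containing [H] meets facet [k]
    in [H] exactly, by cardinality, and complements turn this into the union formula. *)
Let E_shelling i k : (i < k)%N -> (k < q)%N ->
  exists j v, [/\ (j < k)%N, v \in E i, v \notin E k & E j :|: E k = v |: E k].
Proof.
move=> ik kq; have k0 : (0 < k < size s)%N by rewrite (leq_ltn_trans _ ik).
have [_ pure] := s_shelling k0; set Fk := nth finset.set0 s k.
pose G := nth finset.set0 s i :&: Fk.
have GS : G \in shell_part s k.
  by rewrite inE finset.subsetIr; apply/existsP; exists (Ordinal ik); exact: finset.subsetIl.
have [H /maxsetP[HS Hmax] GH] := maxset_exists (P := fun H => H \in shell_part s k) GS.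
have Hcard := pure H HS (fun H' H'S HH' => Hmax H' H'S HH').
move: HS; rewrite inE => /andP[HFk /existsP[[j jk] /= HFj]].
have Hk : #|H|.+1 = #|Fk| by move: Hcard; rewrite -/Fk; move: #|H| #|Fk| => a b; lia.
have jq := ltn_trans jk kq; set Fj := nth finset.set0 s j in HFj.
have FjFk : Fj :&: Fk = H.
  apply/esym/eqP; rewrite eqEcard finset.subsetI HFj HFk /=.
  have : (#|Fj :&: Fk| < #|Fk|)%N.
    apply: proper_card; rewrite properE finset.subsetIr finset.subsetI subxx andbT.
    apply/negP => kj; have := @E_antichain j k jq kq; rewrite finset.setCS => /(_ kj) e.
    by rewrite e ltnn in jk.
  by rewrite -Hk ltnS.
have [v vE] : exists v, Fk :\: H = [set v]%SET.
  by apply/cards1P; rewrite cardsD (finset.setIidPr HFk) -Hk subSnn.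
have : v \in (Fk :\: H)%SET by rewrite vE finset.set11.
rewrite finset.in_setD => /andP[vH vk]; exists j, v; split=> //.
- rewrite finset.in_setC; apply: contra vH => vi; apply: (fintype.subsetP GH).
  by rewrite finset.in_setI vi.
- by rewrite finset.in_setC negbK.
- rewrite -finset.setCI -/Fj -/Fk FjFk; apply/setP => x.
  have : (x \in (Fk :\: H)%SET) = (x == v) by rewrite vE finset.in_set1.
  rewrite finset.in_setD finset.in_setC finset.in_setU1 finset.in_setC -/Fk => <-.
  by have := fintype.subsetP HFk x; case: (x \in H); case: (x \in Fk) => //= /(_ isT).
Qed.

(** The empty face extends to a facet, so there is at least one atom and [top] is not the identity
    relation. *)
Let q_gt0 : (0 < q)%N.
Proof.
have [F /maxsetP[FD Fmax] _] := maxset_exists (P := fun F => F \in D) D_complex.1.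
have : F \in s by apply/s_facets; split=> // G GD FG; exact: Fmax.
by rewrite /q; case: (s).
Qed.

Let top := generated E q [set: 'I_n * 'I_n]%SET.
Let P := between E q (idrel _) top.

Let elt_top x : elt E q x -> x \subset top.
Proof. by move=> ex; rewrite -(elt_generated ex); apply: generatedS; exact: finset.subsetT. Qed.

Let facetP F : is_facet D F -> exists2 i, (i < q)%N & F = nth finset.set0 s i.
Proof. by move=> /s_facets Fs; exists (index F s); rewrite ?index_mem ?nth_index. Qed.

(** A set of facets yields the join of the corresponding atoms; conversely an element is recovered
    from all the facets whose atoms lie below it. *)
Lemma int_latticeE X : int_lattice R D X <-> exists2 x, elt E q x & X = subspace_of R x.
Proof.
split=> [[G [Gf ->]]|[x ex ->]].
  pose x := (\bigcup_(F in G) sq (~: F))%SET.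
  exists (generated E q x); first exact: generated_elt.
  rewrite subspace_of_generated; last first.
    move=> a b /finset.bigcupP[F FG]; rewrite in_sq => /andP[aF bF].
    have /facetP[i iq FE] := Gf _ FG; exists i => //.
    rewrite /E -FE; split=> //; exact: (@finset.bigcup_sup _ _ F (mem G) (fun F => sq (~: F))%SET).
  apply/seteqP; split=> u h.
    move=> a b /finset.bigcupP[F FG]; rewrite in_sq => /andP[aF bF]; exact: (h F FG).
  by move=> F FG a b aF bF; apply: h; apply/finset.bigcupP; exists F => //; rewrite in_sq aF.
exists (finset (fun F => [exists i : 'I_q, (F == nth finset.set0 s i) && (sq (E i) \subset x)])).
split=> [F|]; first by rewrite inE => /existsP[i /andP[/eqP -> _]]; exact: facet_nth.
rewrite -{1}(elt_generated ex); apply/seteqP; split=> u h.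
  move=> F; rewrite inE => /existsP[i /andP[/eqP -> ix]] a b aE bE; apply: h.
  by apply: (fintype.subsetP (sq_generated (ltn_ord i) ix)); rewrite in_sq aE.
move=> a b; rewrite in_generated => /connectP[p]; elim: p a => [|c p IH] a /=; first by move=> _ ->.
move=> /andP[/edgeP[i [iq ix aE cE]] /IH h'] /h' <-.
apply: (h (nth finset.set0 s i)) => //; rewrite inE; apply/existsP; exists (Ordinal iq).
by rewrite eqxx.
Qed.

Lemma lat_topE : lat_top R D = subspace_of R top.
Proof.
apply/seteqP; split=> u h.
  move=> a b; rewrite in_generated => /connectP[p]; elim: p a => [|c p IH] a /=; first by move=> _ ->.
  move=> /andP[/edgeP[i [iq _ aE cE]] /IH h'] /h' <-.
  by apply: (h (nth finset.set0 s i)) => //; exact: facet_nth.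
move=> F /facetP[i iq ->] a b aE bE; apply: h.
have it : sq (E i) \subset [set: 'I_n * 'I_n]%SET by exact: finset.subsetT.
by apply: (fintype.subsetP (sq_generated iq it)); rewrite in_sq aE.
Qed.

Lemma proper_partE X : proper_part R D X <-> exists2 x, x \in P & X = subspace_of R x.
Proof.
have dtop : eqv top by exact: generated_eqv.
have eid : eqv (idrel 'I_n).
  by apply/eqvP; split=> [a|a b|a b c]; rewrite !in_idrel // => /eqP ->.
split=> [[/int_latticeE[x ex ->] [Xb Xt]]|[x /betweenP[ex dx xt] ->]].
  exists x => //; apply/betweenP; split=> //.
    rewrite finset.properEneq (idrel_sub (elt_eqv ex)) andbT.
    by apply: contra_notN Xb => /eqP <-; rewrite subspace_of_idrel.
  rewrite finset.properEneq elt_top // andbT.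
  by apply: contra_notN Xt => /eqP ->; rewrite lat_topE.
split; first by apply/int_latticeE; exists x.
split=> [|].
  rewrite /lat_bot -(subspace_of_idrel R n) => /(subspace_of_inj (elt_eqv ex) eid) e.
  by rewrite e fintype.properxx in dx.
rewrite lat_topE => /(subspace_of_inj (elt_eqv ex) dtop) e.
by rewrite e fintype.properxx in xt.
Qed.

Lemma order_complexE S : order_complex_proper R D S <->
  exists2 C : {set {set 'I_n * 'I_n}}, C \in chains (@sle _) P & S = subspace_of R @` [set x | x \in C].
Proof.
have Pe x : x \in P -> eqv x by move=> /betweenP[/elt_eqv].
split=> [[_ [SP Sch]]|[C /chainsP[/fintype.subsetP CP Cch] ->]].
  pose C : {set {set 'I_n * 'I_n}} := finset (fun x => (x \in P) && `[< S (subspace_of R x) >]).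
  have CS x : x \in C -> x \in P /\ S (subspace_of R x).
    by rewrite inE => /andP[xP /asboolP].
  exists C.
    apply/chainsP; split; first by apply/fintype.subsetP => x /CS[].
    move=> x z /CS[xP xS] /CS[zP zS]; rewrite /sle.
    by case: (Sch _ _ xS zS) => /subspace_of_sub -> //; rewrite ?orbT //; exact: Pe.
  apply/seteqP; split=> [X XS|_ [x /= /CS[_ xS] <-] //].
  have /proper_partE[x xP XE] := SP _ XS; exists x => //=.
  by rewrite inE xP; apply/asboolP; rewrite -XE.
split; first exact: finite_image.
split=> [_ [x /= xC <-]|_ _ [x /= xC <-] [z /= zC <-]].
  by apply/proper_partE; exists x => //; exact: CP.
by case/orP: (Cch _ _ xC zC) => /(@subspace_ofS R); [right|left].
Qed.

Lemma order_complex_wedge :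
  homotopy_wedge_of_spheres R (set_type (realization R (order_complex_proper R D))).
Proof.
have dtop : idrel _ \proper top.
  apply: proper_sub_trans (idrel_atom E_gt1 q_gt0) _; apply: atom_sub; first exact: generated_eqv.
  by apply: sq_generated => //; exact: finset.subsetT.
have [M [MC satM cM]] := sphere_like_between E_gt1 E_antichain E_shelling (leqnn q)
  (generated_elt E q [set: 'I_n * 'I_n]%SET) dtop.
(* If the empty chain is critical, saturation leaves no element in [P]. The realization is then
   empty, as the coordinates of a point would have sum 0 instead of 1. *)
have [M0|M0] := boolP (finset.set0 \in M).
  left=> -[x /= /set_mem[_ [_ [/order_complexE[C CP xC] x1]]]].
  have C0 : C = finset.set0.
    apply/setP => z; rewrite inE; apply/negbTE/negP => zC.
    have := satM _ M0 z (in_chains CP zC); rewrite inE => h.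
    by suff : false by []; apply: h => c; rewrite inE.
  move: x1; rewrite xC C0 fsbig1; last by move=> X [z /=]; rewrite inE.
  by move=> /eqP; rewrite eq_sym oner_eq0.
apply: (@realization_wedge R _ (chains (@sle _) P) M _ _ MC M0 _ cM _ P (subspace_of R) setT).
- by move=> C C' CP C'C; exact: chains_sub CP.
- by apply/chainsP; rewrite finset.sub0set; split=> // x; rewrite inE.
- move=> C C' CM C'P CC'; apply/eqP; rewrite finset.eqEsubset CC' andbT.
  apply/fintype.subsetP => z zC'; apply: satM CM _ (in_chains C'P zC') _ => c cC.
  by case/chainsP: C'P => _ h; apply: h => //; exact: (fintype.subsetP CC').
- by move=> C /chainsP[].
- by move=> x z /betweenP[/elt_eqv ex _ _] /betweenP[/elt_eqv ez _ _]; exact: subspace_of_inj.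
- exact: order_complexE.
Qed.

End DiagonalArrangement.

Theorem theorem1p1 (R : realType) (n : nat) (D : {set {set 'I_n}}) :
  is_simplicial_complex D ->
  dim_le D (n%:Z - 3) ->
  shellable D ->
  homotopy_wedge_of_spheres R
    (set_type (realization R (order_complex_proper R D))).
Proof.
move=> Dc Dd [s [su [sf ss]]]; exact: order_complex_wedge Dc Dd su sf ss.
Qed.
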